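(* Let $H$ be a group and let $H\wr\mathbb{Z} = \left(\bigoplus_{\mathbb{Z}} H\right)\rtimes\mathbb{Z}$. (i) If $H$ acts metrically properly on some space with walls, then $H\wr\mathbb{Z}$ acts metrically properly on some space with walls. (ii) If $H$ acts metrically properly on some $CAT(0)$ cube complex, then $H\wr\mathbb{Z}$ acts metrically properly on some $CAT(0)$ cube complex.
   Context: Wreath product: $\bigoplus_{\mathbb{Z}}H$ is the group of finitely supported functions $\lambda:\mathbb{Z}\to H$ (pointwise multiplication), and $\mathbb{Z}$ acts on it by $(n\cdot\lambda)(x)=\lambda(x-n)$; $H\wr\mathbb{Z}$ is the corresponding semidirect product. A space with walls is a pair $(X,\mathcal{W})$ where $X$ is a set and $\mathcal{W}$ is a set of partitions of $X$ (called walls) into two classes, such that any two points of $X$ are separated by finitely many walls. It is equipped with the (pseudo-)distance $d(x,y)$ = number of walls separating $x$ from $y$. A group acts on $(X,\mathcal{W})$ if it acts on the set $X$ and the action maps walls to walls (hence it preserves $d$). A $CAT(0)$ cube complex is a metric polyhedral complex in which each $k$-cell is isomorphic to the Euclidean cube $[-1/2,1/2]^k$, the gluing maps are isometries, and the resulting metric space is $CAT(0)$ (no finite-dimensionality or local finiteness is assumed). Group actions on cube complexes are by cellular isometries. An action by isometries of a group $G$ on a (pseudo-)metric space $X$ is metrically proper if, for every bounded subset $B\subset X$, the set $\{g\in G: gB\cap B\neq\varnothing\}$ is finite. *)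

(* Defs.v *)
From HB Require Import structures.
From mathcomp Require Import all_boot all_order all_algebra.
From mathcomp Require Import finmap.
From mathcomp Require Import all_classical all_reals.

Set Implicit Arguments.
Unset Strict Implicit.
Unset Printing Implicit Defensive.

Import Order.TTheory GRing.Theory Num.Theory.

Local Open Scope classical_set_scope.
Local Open Scope ring_scope.

Section DirectSum.
Variable H : groupType.

Definition lamps := {fsfun int -> H with 1%g}.

Definition lamps_mul (f g : lamps) : lamps :=
  [fsfun x in (finsupp f `|` finsupp g)%fset => (f x * g x)%g].

Definition lamps_inv (f : lamps) : lamps :=
  [fsfun x in finsupp f => (f x)^-1%g].

Definition lamps_shift (n : int) (f : lamps) : lamps :=
  [fsfun x in [fset (y + n)%R | y in finsupp f]%fset => f (x - n)].

Lemma lamps_mulE f g x : lamps_mul f g x = (f x * g x)%g.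
Proof.
rewrite fsfun_fun in_fsetU; case: ifPn => //; rewrite negb_or => /andP[fx gx].
by rewrite !fsfun_dflt // mulg1.
Qed.

Lemma lamps_invE f x : lamps_inv f x = ((f x)^-1)%g.
Proof.
by rewrite fsfun_fun; case: ifPn => // fx; rewrite fsfun_dflt // invg1.
Qed.

Lemma lamps_shiftE n f x : lamps_shift n f x = f (x - n).
Proof.
rewrite fsfun_fun; case: ifPn => // fx; rewrite fsfun_dflt //.
apply: contra fx => fx; apply/imfsetP; exists (x - n) => //=.
by rewrite subrK.
Qed.

End DirectSum.

(* [Wreath f n] is the pair (f, n) of the semidirect product. *)
Record wreathZ (H : groupType) := Wreath { lamp_part : lamps H ; shift_part : int }.

Section WreathGroup.
Variable H : groupType.
Local Notation W := (wreathZ H).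

Definition pair_of_wreath (a : W) := (lamp_part a, shift_part a).
Definition wreath_of_pair (p : lamps H * int) : W := Wreath p.1 p.2.
Lemma pair_of_wreathK : cancel pair_of_wreath wreath_of_pair.
Proof. by case. Qed.

HB.instance Definition _ := Choice.copy W (can_type pair_of_wreathK).

Definition wreath_one : W := Wreath [fsfun] 0.

Definition wreath_mul (a b : W) : W :=
  Wreath (lamps_mul (lamp_part a) (lamps_shift (shift_part a) (lamp_part b)))
         (shift_part a + shift_part b).

Definition wreath_inv (a : W) : W :=
  Wreath (lamps_shift (- shift_part a) (lamps_inv (lamp_part a)))
         (- shift_part a).

Lemma wreath_mulA : associative wreath_mul.
Proof.
case=> [f m] [g n] [h p]; rewrite /wreath_mul /= addrA; congr Wreath.
apply/fsfunP => x.
by rewrite !(lamps_mulE, lamps_shiftE) mulgA opprD addrA.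
Qed.

Lemma wreath_mul1 : left_id wreath_one wreath_mul.
Proof.
case=> [f m]; rewrite /wreath_mul /= add0r; congr Wreath.
by apply/fsfunP => x; rewrite lamps_mulE lamps_shiftE fsfun0E mul1g subr0.
Qed.

Lemma wreath_mulr1 : right_id wreath_one wreath_mul.
Proof.
case=> [f m]; rewrite /wreath_mul /= addr0; congr Wreath.
by apply/fsfunP => x; rewrite lamps_mulE lamps_shiftE fsfun0E mulg1.
Qed.

Lemma wreath_mulV : left_inverse wreath_one wreath_inv wreath_mul.
Proof.
case=> [f m]; rewrite /wreath_mul /wreath_inv /= addNr; congr Wreath.
apply/fsfunP => x.
by rewrite lamps_mulE !lamps_shiftE lamps_invE fsfun0E mulVg.
Qed.

Lemma wreath_mulrV : right_inverse wreath_one wreath_inv wreath_mul.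
Proof.
case=> [f m]; rewrite /wreath_mul /wreath_inv /= subrr; congr Wreath.
apply/fsfunP => x.
by rewrite lamps_mulE !lamps_shiftE lamps_invE fsfun0E opprK subrK mulgV.
Qed.

HB.instance Definition _ := isGroup.Build W
  wreath_mulA wreath_mul1 wreath_mulr1 wreath_mulV wreath_mulrV.

End WreathGroup.

Definition is_action (G : groupType) (X : Type) (act : G -> X -> X) : Prop :=
  act 1%g =1 id /\ forall g h x, act (g * h)%g x = act g (act h x).

Definition is_bounded (R : realType) (X : Type) (d : X -> X -> R) (B : set X) : Prop :=
  exists M : R, forall x y, B x -> B y -> d x y <= M.

Definition metrically_proper (R : realType) (G : groupType) (X : Type)
    (d : X -> X -> R) (act : G -> X -> X) : Prop :=
  forall B : set X, is_bounded d B ->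
    finite_set [set g | (act g @` B) `&` B !=set0].

Definition is_wall (X : Type) (w : set (set X)) : Prop :=
  partition w id [set: X] /\ (w #= `I_2)%card.

Definition separates (X : Type) (w : set (set X)) (x y : X) : Prop :=
  ~ exists2 A, w A & A x /\ A y.

Record wall_space := WallSpace {
  wpoint : Type;
  walls : set (set (set wpoint));
  wallsP : forall w, walls w -> is_wall w;
  finite_separating : forall x y : wpoint,
    finite_set [set w | walls w /\ separates w x y] }.

Definition wall_dist (X : wall_space) (x y : wpoint X) : nat :=
  #|` fset_set [set w | @walls X w /\ separates w x y]|.

Definition preserves_walls (X : wall_space) (f : wpoint X -> wpoint X) : Prop :=
  forall w, @walls X w -> @walls X [set f @` A | A in w].

(* Nonemptiness is required because every action on the empty set is
   metrically proper. *)
Definition acts_properly_on_walls (R : realType) (G : groupType) : Prop :=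
  exists (X : wall_space) (act : G -> wpoint X -> wpoint X),
    [/\ [set: wpoint X] !=set0,
        is_action act,
        forall g, preserves_walls (act g)
      & metrically_proper (fun x y => (wall_dist x y)%:R : R) act].

(* The library's norm on 'rV[R]_n is the sup norm. *)
Definition edist (R : realType) (n : nat) (x y : 'rV[R]_n) : R :=
  Num.sqrt (\sum_(i < n) (x 0 i - y 0 i) ^+ 2).

Section CAT0.
Variables (R : realType) (X : Type) (d : X -> X -> R).

Definition is_metric : Prop :=
  [/\ forall x y, d x y = 0 <-> x = y,
      forall x y, d x y = d y x
    & forall x y z, d x z <= d x y + d y z].

Definition geodesic_segment (x y : X) (S : set X) : Prop :=
  exists c : R -> X,
    [/\ c 0 = x, c (d x y) = y,
        forall s t, 0 <= s <= d x y -> 0 <= t <= d x y ->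
          d (c s) (c t) = `|s - t|
      & S = c @` [set t | 0 <= t <= d x y]].

Definition geodesic_space : Prop :=
  forall x y, exists S, geodesic_segment x y S.

(* [u] is the comparison point on the Euclidean segment [p', q'] of a point [x]
   of a geodesic segment issued from [p]. *)
Definition comparison_point (p : X) (p' q' : 'rV[R]_2) (x : X) (u : 'rV[R]_2)
    : Prop :=
  (exists2 t : R, 0 <= t <= 1 & u = (1 - t) *: p' + t *: q') /\
  edist p' u = d p x.

Definition cat0 : Prop :=
  [/\ is_metric, geodesic_space
    & forall (p q r : X) (pq qr rp : set X) (p' q' r' : 'rV[R]_2),
        geodesic_segment p q pq -> geodesic_segment q r qr ->
        geodesic_segment r p rp ->
        edist p' q' = d p q -> edist q' r' = d q r -> edist r' p' = d r p ->
        let on_triangle x u :=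
          [\/ pq x /\ comparison_point p p' q' x u,
              qr x /\ comparison_point q q' r' x u
            | rp x /\ comparison_point r r' p' x u] in
        forall x y u v, on_triangle x u -> on_triangle y v ->
          d x y <= edist u v].

End CAT0.

Definition cube (R : realType) (n : nat) : set 'rV[R]_n :=
  [set x | forall i, `|x 0 i| <= 2^-1].

(* The smallest face of the cube containing [x]. The nonempty faces of the cube
   are exactly these sets, and the relative interior of a face is the set of
   points whose support is that face. *)
Definition face_support (R : realType) (n : nat) (x : 'rV[R]_n) : set 'rV[R]_n :=
  [set y | cube y /\ forall i, `|x 0 i| = 2^-1 -> y 0 i = x 0 i].

(* A metric polyhedral complex with cubical cells, as in Bridson-Haefliger,
   Definition I.7.37. The quotient of the disjoint union of the cubes is
   presented by its set of points [cpoint] and its projections [chart c], whose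
   values outside the cube are irrelevant. *)
Record cube_complex (R : realType) := CubeComplex {
  cpoint : Type;
  cell : Type;
  cdim : cell -> nat;
  chart : forall c : cell, 'rV[R]_(cdim c) -> cpoint;
  chart_surj : forall x, exists c, exists2 u : 'rV[R]_(cdim c), cube u & chart u = x;
  chart_inj : forall c (u v : 'rV[R]_(cdim c)), cube u -> cube v ->
    face_support u = face_support v -> chart u = chart v -> u = v;
  gluing_isometry : forall c c' (u : 'rV[R]_(cdim c)) (u' : 'rV[R]_(cdim c')),
    cube u -> cube u' -> chart u = chart u' ->
    exists h : 'rV[R]_(cdim c) -> 'rV[R]_(cdim c'),
      [/\ set_bij (face_support u) (face_support u') h,
          forall v w, face_support u v -> face_support u w ->
            edist (h v) (h w) = edist v w
        & forall v, face_support u v -> chart v = chart (h v)] }.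

Section Complex.
Variables (R : realType) (K : cube_complex R).

(* [chain x y l]: there is a piecewise linear path of length [l] from [x] to
   [y], each piece of which lies in a cell. *)
Inductive chain : cpoint K -> cpoint K -> R -> Prop :=
| chain_nil x : chain x x 0
| chain_cons (c : cell K) (u v : 'rV[R]_(cdim c)) y l :
    cube u -> cube v -> chain (chart v) y l -> chain (chart u) y (edist u v + l).

(* The infimum of the empty set is 0, hence the separate connectedness
   requirement in [cat0_complex]. *)
Definition complex_dist (x y : cpoint K) : R := inf [set l | chain x y l].

Definition cat0_complex : Prop :=
  (forall x y, exists l, chain x y l) /\ cat0 complex_dist.

Definition closed_cell (S : set (cpoint K)) : Prop :=
  exists c, exists2 u : 'rV[R]_(cdim c), cube u & S = @chart R K c @` face_support u.

Definition cellular_isometry (f : cpoint K -> cpoint K) : Prop :=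
  (forall x y, complex_dist (f x) (f y) = complex_dist x y) /\
  (forall S, closed_cell S -> closed_cell (f @` S)).

End Complex.

Definition acts_properly_on_cat0_cube_complex (R : realType) (G : groupType)
    : Prop :=
  exists (K : cube_complex R) (act : G -> cpoint K -> cpoint K),
    [/\ [set: cpoint K] !=set0,
        cat0_complex K,
        is_action act,
        forall g, cellular_isometry (act g)
      & metrically_proper (@complex_dist R K) act].

(* Main.v *)
Require Import Defs.
From mathcomp Require Import all_boot all_order all_algebra.
From mathcomp Require Import finmap.
From mathcomp Require Import all_classical all_reals.
From mathcomp Require Import zify ring lra.

(** Both parts rest on the same picture.  The wreath product permutes the
    factors of a restricted product (families equal to a base point at almost
    every index) which has one copy of the given space of [H] at each integer,
    together with two more factors.  A pair [(f, n)] shifts the copies by [n] and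
    then moves the copy at [i] by the lamp [f i]; almost all lamps are trivial,
    so the base point is moved at finitely many indices only.  The copies alone
    do not give a proper action, because translations fix the base point and
    lamps far from the origin cost no more than lamps close to it.  The two more
    factors correct this.  They are two copies of a tree whose points are pairs
    of a height [r] and of the germ at [+oo] of a lamp configuration, namely its
    values at the integers [i > r - 1]; the group acts on one of them directly
    and on the other one through the reflection of the line.  Moving the base
    point [(0, 1)] of the tree to its image costs at least the shift and at least
    the position of the last lamp that is on.  A bound on the displacement of
    the base point of the product thus bounds the shift and the support
    ([tree_act_base], [wall_dist_one_bound]) and, by properness for [H], leaves
    finitely many values for each lamp, hence finitely many elements
    ([finite_wreath_ball]).

    For walls, the walls of the product are the preimages of the walls of the
    factors, and the tree enters through its halfspaces, pulled back to the
    group.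

    For cube complexes, the product has to be a cube complex that is CAT(0).  Its
    cells are products of cells, almost all of them the base vertex; the base
    point of each factor is first made a cell of its own ([add_vertex]).  Its
    length metric is the Euclidean sum of those of the factors
    ([complex_dist_product]): one inequality is checked inside a cell, the other
    one runs nearly shortest chains of the factors simultaneously at
    proportional speeds ([chain_merge]).  A metric is CAT(0) if and only if any
    two points [x], [y] have, for each ratio [t], a point [m] with
      [d p m ^+ 2 <= (1 - t) * d p x ^+ 2 + t * d p y ^+ 2 - t * (1 - t) * d x y ^+ 2]
    for all [p] ([cat0_of_stewart], [stewart_of_cat0]).  This inequality is
    affine in squared distances, so it passes to Euclidean sums by addition
    ([stewart_l2dist]); it holds in the tree because a point of a geodesic
    separates every [p] from one of the two ends ([stewart_tree]). *)

Set Implicit Arguments.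
Unset Strict Implicit.
Unset Printing Implicit Defensive.

Import Order.TTheory GRing.Theory Num.Theory.

Local Open Scope classical_set_scope.
Local Open Scope ring_scope.

(** * Euclidean distances *)

Section Euclid.
Variable R : realType.
Implicit Types (n : nat) (s t : R).

Lemma ler_of_sqr s t : 0 <= t -> s ^+ 2 <= t ^+ 2 -> s <= t.
Proof. by move=> t0 st; nra. Qed.

Lemma edist_ge0 n (x y : 'rV[R]_n) : 0 <= edist x y.
Proof. exact: sqrtr_ge0. Qed.

Lemma sqr_edist n (x y : 'rV[R]_n) :
  edist x y ^+ 2 = \sum_(i < n) (x 0 i - y 0 i) ^+ 2.
Proof. by rewrite sqr_sqrtr // sumr_ge0 // => i _; exact: sqr_ge0. Qed.

Lemma edist_sym n (x y : 'rV[R]_n) : edist x y = edist y x.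
Proof. by congr Num.sqrt; apply: eq_bigr => i _; rewrite -sqrrN opprB. Qed.

Lemma edist_xx n (x : 'rV[R]_n) : edist x x = 0.
Proof.
by rewrite /edist big1 ?sqrtr0 // => i _; rewrite subrr expr0n.
Qed.

(** Stewart's theorem. *)
Lemma sqr_edist_combination n (z p q : 'rV[R]_n) t :
  edist z ((1 - t) *: p + t *: q) ^+ 2 =
  (1 - t) * edist z p ^+ 2 + t * edist z q ^+ 2
    - t * (1 - t) * edist p q ^+ 2.
Proof.
rewrite !sqr_edist !mulr_sumr -big_split -sumrB /=.
by apply: eq_bigr => i _; rewrite !mxE; ring.
Qed.

Lemma edist_combination n (p q : 'rV[R]_n) t : 0 <= t ->
  edist p ((1 - t) *: p + t *: q) = t * edist p q.
Proof.
move=> t0; apply/eqP; rewrite -(@eqrXn2 _ 2) ?mulr_ge0 ?edist_ge0 //.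
by rewrite sqr_edist_combination edist_xx; apply/eqP; ring.
Qed.

Definition vec2 (a b : R) : 'rV[R]_2 := \row_j (if j == 0 then a else b).

Lemma edist_vec2 (a b c d : R) :
  edist (vec2 a b) (vec2 c d) = Num.sqrt ((a - c) ^+ 2 + (b - d) ^+ 2).
Proof.
by rewrite /edist big_ord_recl big_ord_recl big_ord0 addr0 !mxE.
Qed.

Lemma comparison_triangle (a b c : R) : 0 <= a -> 0 <= b -> 0 <= c ->
  a <= b + c -> b <= a + c -> c <= a + b ->
  exists x y p : 'rV[R]_2,
    [/\ edist x y = a, edist x p = b & edist y p = c].
Proof.
move=> a0 b0 c0 abc bac cab.
have [az|anz] := eqVneq a 0.
  exists (vec2 0 0), (vec2 0 0), (vec2 b 0).
  rewrite edist_xx edist_vec2 subrr expr0n /= addr0 sqrtr_sqr sub0r normrN.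
  by rewrite ger0_norm //; split => //; lra.
have ap : 0 < a by rewrite lt0r anz.
pose u := (a ^+ 2 + b ^+ 2 - c ^+ 2) / (2 * a).
have uE : 2 * a * u = a ^+ 2 + b ^+ 2 - c ^+ 2.
  by rewrite /u; field.
have ub : u ^+ 2 <= b ^+ 2.
  have lo : - b <= u by nra.
  have hi : u <= b by nra.
  by nra.
exists (vec2 0 0), (vec2 a 0), (vec2 u (Num.sqrt (b ^+ 2 - u ^+ 2))).
rewrite !edist_vec2 subrr expr0n /= addr0 sqrtr_sqr !sub0r normrN.
rewrite ger0_norm // !sqrrN sqr_sqrtr ?subr_ge0 // addrC subrK sqrtr_sqr.
split=> //; first by rewrite ger0_norm.
have -> : (a - u) ^+ 2 + (b ^+ 2 - u ^+ 2) = c ^+ 2 by nra.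
by rewrite sqrtr_sqr ger0_norm.
Qed.

End Euclid.

(** * The Bruhat-Tits form of the CAT(0) inequality *)

Section StewartInequality.
Variables (R : realType) (X : Type) (d : X -> X -> R).

(** [m] satisfies Stewart's theorem with an inequality, for the point dividing
    the segment from [x] to [y] in the ratio [t].  Unlike the comparison of
    triangles, this condition mentions no geodesic and is affine in squared
    distances. *)
Definition stewart_point (x y : X) (t : R) (m : X) : Prop :=
  forall p, d p m ^+ 2 <=
    (1 - t) * d p x ^+ 2 + t * d p y ^+ 2 - t * (1 - t) * d x y ^+ 2.

Definition stewart : Prop :=
  forall x y t, 0 <= t <= 1 -> exists m, stewart_point x y t m.

Hypothesis dm : is_metric d.

Lemma metric_xx x : d x x = 0.
Proof. by have [e _ _] := dm; apply/e. Qed.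

Lemma metric_sym x y : d x y = d y x.
Proof. by have [_ s _] := dm. Qed.

Lemma metric_tri y x z : d x z <= d x y + d y z.
Proof. by have [_ _ t] := dm. Qed.

Lemma metric_eq x y : d x y = 0 -> x = y.
Proof. by have [e _ _] := dm => /e. Qed.

Lemma metric_ge0 x y : 0 <= d x y.
Proof.
by have := metric_tri y x x; rewrite metric_xx (metric_sym y x); lra.
Qed.

Lemma stewart_point_unique x y t m z : 0 <= t <= 1 -> stewart_point x y t m ->
  d x z = t * d x y -> d z y = (1 - t) * d x y -> z = m.
Proof.
move=> /andP[t0 t1] /(_ z) mP xz zy; apply: metric_eq.
have z0 := metric_ge0 z m; apply/eqP; rewrite -sqrf_eq0 eq_le sqr_ge0 andbT.
by move: mP; rewrite (metric_sym z x) xz zy; nra.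
Qed.

Lemma dist_stewart_point x y t m : 0 <= t <= 1 -> stewart_point x y t m ->
  d x m = t * d x y /\ d m y = (1 - t) * d x y.
Proof.
move=> /andP[t0 t1] mP; have d0 := metric_ge0 x y.
have xm : d x m <= t * d x y.
  apply: ler_of_sqr; first exact: mulr_ge0.
  by apply: le_trans (mP x) _; rewrite metric_xx; nra.
have my : d m y <= (1 - t) * d x y.
  apply: ler_of_sqr; first by rewrite mulr_ge0 // subr_ge0.
  rewrite metric_sym; apply: le_trans (mP y) _.
  by rewrite metric_xx (metric_sym y x); nra.
by have := metric_tri m x y; split; lra.
Qed.

(** The points provided for the ratios [t] trace a geodesic: the inequality for
    the ratio of one of them, tested on another, bounds their distance by that of
    their parameters. *)
Lemma stewart_geodesic : stewart -> geodesic_space d.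
Proof.
move=> st x y; have d0 := metric_ge0 x y.
have [xy|xy] := eqVneq (d x y) 0.
  exists [set x], (fun=> x); split => //; rewrite ?xy.
  - exact: metric_eq.
  - move=> s t s0 t0; rewrite metric_xx.
    by have [-> ->] : s = 0 /\ t = 0; rewrite ?subrr ?normr0 //; split; lra.
  - rewrite eqEsubset; split=> z /=; first by move=> ->; exists 0; rewrite /= ?lexx.
    by case=> ? _ ->.
have dp : 0 < d x y by rewrite lt0r xy.
have /choice[c cP] : forall t : R, exists m,
    0 <= t <= d x y -> stewart_point x y (t / d x y) m.
  move=> t; have [t01|/negP nt] := boolP (0 <= t <= d x y); last by exists x.
  have [|m mP] := st x y (t / d x y); last by exists m.
  by rewrite divr_ge0 ?ler_pdivrMr ?mul1r; case/andP: t01.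
have cd t : 0 <= t <= d x y -> d x (c t) = t /\ d (c t) y = d x y - t.
  move=> t01; have [||-> ->] := @dist_stewart_point x y (t / d x y) (c t).
  - by rewrite divr_ge0 ?ler_pdivrMr ?mul1r; case/andP: t01.
  - exact: cP.
  - by rewrite mulrBl mul1r !mulfVK.
have i0 : 0 <= (0 : R) <= d x y by rewrite lexx ?andTb.
have i1 : 0 <= d x y <= d x y by rewrite lexx andbT.
exists (c @` [set t | 0 <= t <= d x y]), c; split => //.
- by have [/metric_eq] := cd 0 i0.
- by have [_] := cd _ i1; rewrite subrr => /metric_eq.
suff ct s t : 0 <= s <= d x y -> 0 <= t <= d x y -> d (c s) (c t) = `|s - t|.
  by move=> s t; exact: ct.
wlog st' : s t / s <= t => [W|] s01 t01.
  have [/W->//|/ltW ts] := leP s t.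
  by rewrite metric_sym distrC (W _ _ ts).
rewrite ler0_norm ?subr_le0 // opprB; apply: le_anti; apply/andP; split; last first.
  have [xs _] := cd _ s01; have [xt _] := cd _ t01.
  by have := metric_tri (c s) x (c t); rewrite xs xt; lra.
have [xs sy] := cd _ s01.
apply: ler_of_sqr; first by rewrite subr_ge0.
have := cP _ t01 (c s); rewrite (metric_sym (c s) x) xs sy.
suff -> : (1 - t / d x y) * s ^+ 2 + t / d x y * (d x y - s) ^+ 2 -
   t / d x y * (1 - t / d x y) * d x y ^+ 2 = (t - s) ^+ 2 by [].
by field.
Qed.

(** The points of any geodesic are determined by their distances to its ends,
    hence they are the points that satisfy the inequality. *)
Lemma segment_point p q S (p' q' : 'rV[R]_2) x u :
  geodesic_segment d p q S -> edist p' q' = d p q -> S x ->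
  comparison_point d p p' q' x u -> stewart ->
  exists t, [/\ 0 <= t <= 1, u = (1 - t) *: p' + t *: q' & stewart_point p q t x].
Proof.
case=> c [c0 c1 cd ->] pq' [s s01 <-] [[t t01 uE] pu] st.
have [t0 t1] := andP t01; have [s0 s1] := andP s01.
have d0 := metric_ge0 p q.
have ps : d p (c s) = s.
  by rewrite -[in LHS]c0 cd ?lexx // sub0r normrN ger0_norm.
have sq : d (c s) q = d p q - s.
  by rewrite -[in LHS]c1 cd ?lexx ?andbT // distrC ger0_norm // subr_ge0.
have sE : s = t * d p q by rewrite -ps -pu uE edist_combination // pq'.
exists t; split => //.
have [m mP] := st p q t t01.
suff -> : c s = m by [].
by apply: stewart_point_unique t01 mP _ _; rewrite ?ps ?sq sE //; ring.
Qed.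

(** The inequality is used from [y] to the segment of [x], then from [x] to the
    segment of [y]; the same computation is an equality in the Euclidean
    plane.  Allowing arbitrary pairs of ends treats all pairs of sides of a
    triangle at once. *)
Lemma stewart_comparison a b a' b' (u v u' v' : 'rV[R]_2) t s x y :
  0 <= t <= 1 -> 0 <= s <= 1 ->
  stewart_point a b t x -> stewart_point a' b' s y ->
  edist u v = d a b -> edist u' v' = d a' b' ->
  edist u u' = d a a' -> edist u v' = d a b' ->
  edist v u' = d b a' -> edist v v' = d b b' ->
  d x y <= edist ((1 - t) *: u + t *: v) ((1 - s) *: u' + s *: v').
Proof.
move=> /andP[t0 t1] /andP[s0 s1] xP yP ab a'b' aa' ab' ba' bb'.
apply: ler_of_sqr; first exact: edist_ge0.
apply: le_trans (yP x) _; rewrite sqr_edist_combination a'b' lerD2r.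
rewrite ![edist (_ + _) _]edist_sym !sqr_edist_combination ab.
rewrite ![edist u' _]edist_sym ![edist v' _]edist_sym aa' ab' ba' bb'.
rewrite !(metric_sym x).
rewrite (metric_sym a a') (metric_sym b a') (metric_sym a b') (metric_sym b b').
by apply: lerD; apply: ler_wpM2l; rewrite ?subr_ge0 //; exact: xP.
Qed.

Lemma cat0_of_stewart : stewart -> cat0 d.
Proof.
move=> st; split=> // [|p q r pq qr rp p' q' r' pqS qrS rpS epq eqr erp].
  exact: stewart_geodesic.
move=> on_triangle x y u v.
have eqp := epq; rewrite edist_sym metric_sym in eqp.
have erq := eqr; rewrite edist_sym metric_sym in erq.
have epr := erp; rewrite edist_sym metric_sym in epr.
have exx z (w : 'rV[R]_2) : edist w w = d z z by rewrite edist_xx metric_xx.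
have side z w : on_triangle z w -> exists a b a' b' t,
    [/\ 0 <= t <= 1, w = (1 - t) *: a' + t *: b', stewart_point a b t z &
     [\/ [/\ a = p, b = q, a' = p' & b' = q'],
         [/\ a = q, b = r, a' = q' & b' = r']
       | [/\ a = r, b = p, a' = r' & b' = p']]].
  case=> -[zS zw].
  - have [t [t01 wE zt]] := segment_point pqS epq zS zw st.
    by exists p, q, p', q', t; split => //; constructor 1.
  - have [t [t01 wE zt]] := segment_point qrS eqr zS zw st.
    by exists q, r, q', r', t; split => //; constructor 2.
  - have [t [t01 wE zt]] := segment_point rpS erp zS zw st.
    by exists r, p, r', p', t; split => //; constructor 3.
move=> /side[a [b [a' [b' [t [t01 -> xt xe]]]]]].
move=> /side[c [e [c' [e' [s [s01 -> ys ye]]]]]].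
apply: (stewart_comparison t01 s01 xt ys);
  by case: xe => -[? ? ? ?]; case: ye => -[? ? ? ?]; subst.
Qed.

(** Conversely, [p] is a vertex of a triangle with the segment from [x] to [y] as
    opposite side, and the comparison triangle satisfies Stewart's theorem. *)
Lemma stewart_of_cat0 : cat0 d -> stewart.
Proof.
move=> [_ geo cmp] x y t t01; have [t0 t1] := andP t01.
have [S [c [c0 c1 cd SE]]] := geo x y.
have d0 := metric_ge0 x y.
have td : 0 <= t * d x y <= d x y by rewrite mulr_ge0 //= ler_piMl.
exists (c (t * d x y)) => p.
have [x' [y' [p' [exy exp eyp]]]] := comparison_triangle d0 (metric_ge0 x p)
  (metric_ge0 y p) ltac:(by rewrite (metric_sym y); exact: metric_tri)
  (metric_tri y x p) ltac:(by rewrite (metric_sym x y); exact: metric_tri).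
have [S1 S1P] := geo y p; have [S2 S2P] := geo p x.
have xyS : geodesic_segment d x y S by exists c.
have epx : edist p' x' = d p x by rewrite edist_sym exp metric_sym.
have h : d (c (t * d x y)) p <= edist ((1 - t) *: x' + t *: y') p'.
  apply: (cmp x y p S S1 S2 x' y' p' xyS S1P S2P exy eyp epx).
  - constructor 1; split; first by rewrite SE; exists (t * d x y).
    split; first by exists t.
    rewrite edist_combination // exy.
    have := cd 0 (t * d x y); rewrite c0 => -> //; last by rewrite lexx.
    by rewrite sub0r normrN ger0_norm //; case/andP: td.
  - constructor 2; split.
      case: S1P => c' [c0' c1' cd' ->]; exists (d y p) => //=.
      by rewrite metric_ge0 lexx.
    split; last exact: eyp.
    by exists 1; rewrite ?ler01 ?lexx // subrr scale0r add0r scale1r.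
move: (c _) h => m h.
rewrite (metric_sym p m) (metric_sym p x) (metric_sym p y) -exy -exp -eyp.
rewrite (edist_sym x' p') (edist_sym y' p') -sqr_edist_combination.
rewrite (edist_sym p') ler_pXn2r ?nnegrE ?edist_ge0 //.
exact: metric_ge0.
Qed.

End StewartInequality.

(** * Restricted products *)

(** Families that coincide with a fixed base family at all but finitely many
    indices: the common home of the infinitely many copies of the space of [H]
    and of the two auxiliary coordinates. *)
Section RestrictedProduct.
Variables (I : choiceType) (X : I -> Type) (b : forall i, X i).

Definition rprod := {x : forall i, X i | finite_set [set i | x i <> b i]}.

Implicit Types x y : rprod.

Lemma rprod_eq x y : (forall i, sval x i = sval y i) -> x = y.
Proof.
case: x y => [x ?] [y ?] /= xy; apply: eq_exist.
exact: functional_extensionality_dep.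
Qed.

Lemma finite_base : finite_set [set i | b i <> b i].
Proof. by apply: sub_finite_set (finite_set0 I) => i /=. Qed.

Definition rbase : rprod := exist _ b finite_base.

Lemma finite_supp x : finite_set [set i | sval x i <> b i].
Proof. exact: svalP x. Qed.

Lemma finite_diff x y : finite_set [set i | sval x i <> sval y i].
Proof.
apply: (@sub_finite_set _ _ ([set i | sval x i <> b i] `|` [set i | sval y i <> b i])).
  move=> i /= xy; have [xb|xb] := pselect (sval x i = b i); last by left.
  by right=> yb; apply: xy; rewrite xb yb.
by rewrite finite_setU; split; exact: finite_supp.
Qed.

Definition rsupp x y : {fset I} :=
  fset_set ([set i | sval x i <> b i] `|` [set i | sval y i <> b i]).

Lemma rsuppP x y i : i \notin rsupp x y -> sval x i = b i /\ sval y i = b i.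
Proof.
rewrite in_fset_set; last by rewrite finite_setU; split; exact: finite_supp.
by rewrite notin_setE /= => /not_orP[/contrapT ? /contrapT ?].
Qed.

Lemma finite_upd x j (a : X j) :
  finite_set [set i | eqtype.dfwith (sval x) a i <> b i].
Proof.
apply: (@sub_finite_set _ _ ([set i | sval x i <> b i] `|` [set j])).
  by move=> i /=; case: eqtype.dfwithP => [|k _]; [right | left].
by rewrite finite_setU; split; [exact: finite_supp | exact: finite_set1].
Qed.

Definition upd x j (a : X j) : rprod := exist _ (eqtype.dfwith (sval x) a) (finite_upd x a).

Lemma upd_in x j (a : X j) : sval (upd x a) j = a.
Proof. exact: eqtype.dfwith_in. Qed.

Lemma upd_out x j (a : X j) i : j != i -> sval (upd x a) i = sval x i.
Proof. exact: eqtype.dfwith_out. Qed.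

Lemma finite_relabel (tau : I -> I) (phi : forall j, X (tau j) -> X j) x :
  injective tau -> finite_set [set j | phi j (b (tau j)) <> b j] ->
  finite_set [set j | phi j (sval x (tau j)) <> b j].
Proof.
move=> tauI fin; apply: sub_finite_set (_ : finite_set
  ([set j | phi j (b (tau j)) <> b j] `|` [set j | sval x (tau j) <> b (tau j)])).
  move=> j /= nb; have [e|] := pselect (sval x (tau j) = b (tau j)); last by right.
  by left; rewrite -e.
rewrite finite_setU; split => //.
exact: (finite_preimage (in2W tauI) (finite_supp x)).
Qed.

(** The form in which the wreath product acts: the shift permutes the indices
    and the lamps move the factors. *)
Definition relabel tau phi (tauI : injective tau)
    (fin : finite_set [set j | phi j (b (tau j)) <> b j]) x : rprod :=
  exist _ (fun j => phi j (sval x (tau j))) (finite_relabel x tauI fin).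

(** The factor at [i] is that at [tau j] only up to the equality [tau j = i], so
    the family is found as the unique one whose transports are the [z j]. *)
Lemma unrelabel (tau : I -> I) (z : forall j, X (tau j)) : bijective tau ->
  exists x : forall i, X i, forall j, x (tau j) = z j.
Proof.
move=> bij; have tauI := bij_inj bij; case: bij => rho _ rhoK.
have h i : exists xi : X i,
    forall j (e : tau j = i), xi = eq_rect _ X (z j) _ e.
  rewrite -(rhoK i); exists (z (rho i)) => j e.
  by have ej := tauI _ _ e; subst j; rewrite (eq_irrelevance e erefl).
exists (fun i => sval (cid (h i))) => j.
by case: cid => xi /= /(_ j erefl).
Qed.

End RestrictedProduct.

(** * Euclidean sums of metric spaces *)

Section Minkowski.
Variable R : realType.
Implicit Types a b c d u v : R.

Lemma minkowski2 a b c d :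
  Num.sqrt ((a + c) ^+ 2 + (b + d) ^+ 2) <=
  Num.sqrt (a ^+ 2 + b ^+ 2) + Num.sqrt (c ^+ 2 + d ^+ 2).
Proof.
have sq u v : 0 <= u ^+ 2 + v ^+ 2 by rewrite addr_ge0 ?sqr_ge0.
apply: ler_of_sqr; first by rewrite addr_ge0 ?sqrtr_ge0.
rewrite sqr_sqrtr // [leRHS]sqrrD !sqr_sqrtr //.
suff : a * c + b * d <= Num.sqrt (a ^+ 2 + b ^+ 2) * Num.sqrt (c ^+ 2 + d ^+ 2).
  by lra.
apply: ler_of_sqr; first by rewrite mulr_ge0 ?sqrtr_ge0.
rewrite exprMn !sqr_sqrtr // -subr_ge0.
have -> : (a ^+ 2 + b ^+ 2) * (c ^+ 2 + d ^+ 2) - (a * c + b * d) ^+ 2 =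
  (a * d - b * c) ^+ 2 by ring.
exact: sqr_ge0.
Qed.

(** Equality in the triangle inequality for parallel vectors: moving in two
    factors at proportional speeds wastes no length. *)
Lemma sqrt_parallel a b c d : 0 <= a -> 0 <= b -> 0 <= c -> 0 <= d ->
  a * d = b * c ->
  Num.sqrt (a ^+ 2 + b ^+ 2) + Num.sqrt (c ^+ 2 + d ^+ 2) =
  Num.sqrt ((a + c) ^+ 2 + (b + d) ^+ 2).
Proof.
move=> a0 b0 c0 d0 e.
have sq u v : 0 <= u ^+ 2 + v ^+ 2 by rewrite addr_ge0 ?sqr_ge0.
apply/eqP; rewrite -(@eqrXn2 _ 2) ?addr_ge0 ?sqrtr_ge0 //.
rewrite sqrrD !sqr_sqrtr // -sqrtrM //.
suff -> : (a ^+ 2 + b ^+ 2) * (c ^+ 2 + d ^+ 2) = (a * c + b * d) ^+ 2.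
  by rewrite sqrtr_sqr ger0_norm ?addr_ge0 ?mulr_ge0 //; apply/eqP; ring.
have : (a * d - b * c) ^+ 2 = 0 by rewrite e subrr expr0n.
by move=> h; rewrite -[RHS]addr0 -h; ring.
Qed.

Lemma minkowski_seq (I : Type) (s : seq I) (u v : I -> R) :
  Num.sqrt (\sum_(i <- s) (u i + v i) ^+ 2) <=
  Num.sqrt (\sum_(i <- s) u i ^+ 2) + Num.sqrt (\sum_(i <- s) v i ^+ 2).
Proof.
elim: s => [|i s IH]; first by rewrite !big_nil sqrtr0 addr0.
have sq (w : I -> R) : 0 <= \sum_(j <- s) w j ^+ 2.
  by rewrite sumr_ge0 // => j _; exact: sqr_ge0.
rewrite !big_cons -(sqr_sqrtr (sq _)) -(sqr_sqrtr (sq u)) -(sqr_sqrtr (sq v)).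
apply: le_trans (minkowski2 _ _ _ _).
by rewrite ler_sqrt ?addr_ge0 ?sqr_ge0 // lerD2l lerXn2r ?nnegrE ?addr_ge0 ?sqrtr_ge0.
Qed.

End Minkowski.

Section EuclideanSum.
Variables (R : realType) (I : choiceType) (X : I -> Type) (b : forall i, X i).
Variable d : forall i, X i -> X i -> R.
Hypothesis dm : forall i, is_metric (@d i).
Implicit Types x y z : rprod b.

Definition l2dist2 x y : R := \sum_(i \in [set: I]) d (sval x i) (sval y i) ^+ 2.

Definition l2dist x y : R := Num.sqrt (l2dist2 x y).

Lemma l2dist2E (A : {fset I}) x y :
  (forall i, i \notin A -> sval x i = sval y i) ->
  l2dist2 x y = \sum_(i <- A) d (sval x i) (sval y i) ^+ 2.
Proof.
move=> xy; rewrite /l2dist2 -(fsbig_widen [set` A]) //.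
  by rewrite -fsbig_seq // fset_uniq.
move=> i [_ /= /negP iA]; rewrite xy // metric_xx ?expr0n //; exact: dm.
Qed.

Lemma l2dist2_ge0 x y : 0 <= l2dist2 x y.
Proof. by rewrite fsumr_ge0 // => i _; exact: sqr_ge0. Qed.

Lemma sqr_l2dist x y : l2dist x y ^+ 2 = l2dist2 x y.
Proof. exact: sqr_sqrtr (l2dist2_ge0 x y). Qed.

Lemma le_l2dist x y i : d (sval x i) (sval y i) <= l2dist x y.
Proof.
apply: ler_of_sqr; first exact: sqrtr_ge0.
rewrite sqr_l2dist (@l2dist2E (i |` rsupp x y)%fset); last first.
  by move=> j; rewrite in_fsetU negb_or => /andP[_ /rsuppP[-> ->]].
rewrite (big_fsetD1 i) ?fset1U1 //= lerDl.
by rewrite sumr_ge0 // => j _; exact: sqr_ge0.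
Qed.

Lemma l2dist_metric : is_metric l2dist.
Proof.
split=> [x y|x y|x y z].
- split=> [xy|->]; last first.
    by rewrite /l2dist (@l2dist2E fset0) // big_seq_fset0 sqrtr0.
  apply: rprod_eq => i; apply: (metric_eq (dm i)).
  by apply: le_anti; rewrite (metric_ge0 (dm i)) andbT -xy le_l2dist.
- by congr Num.sqrt; apply: eq_fsbigr => i _; rewrite (metric_sym (dm i)).
- pose A := (rsupp x y `|` rsupp y z)%fset.
  have [xy yz] : (forall i, i \notin A -> sval x i = sval y i) /\
                 (forall i, i \notin A -> sval y i = sval z i).
    by split=> i; rewrite in_fsetU negb_or => /andP[/rsuppP[xb yb] /rsuppP[_ zb]];
      rewrite ?xb ?yb ?zb.
  rewrite /l2dist (l2dist2E xy) (l2dist2E yz) (@l2dist2E A); last first.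
    by move=> i iA; rewrite xy // yz.
  apply: le_trans (minkowski_seq _ _ _).
  rewrite ler_sqrt; last by rewrite sumr_ge0 // => i _; exact: sqr_ge0.
  apply: ler_sum => i _; rewrite lerXn2r ?nnegrE ?addr_ge0 ?(metric_ge0 (dm i)) //.
  exact: metric_tri (dm i) _ _ _.
Qed.

(** The inequalities of the factors are summed.  Where both endpoints sit at the
    base point, so does the point provided by the factor, because its distance to
    them is at most [0]; hence these points form a point of the product. *)
Lemma stewart_l2dist : (forall i, stewart (@d i)) -> stewart l2dist.
Proof.
move=> st x y t t01; have [t0 t1] := andP t01.
have mP0 i := cid (st i (sval x i) (sval y i) t t01).
pose m i := sval (mP0 i).
have mP i : stewart_point (@d i) (sval x i) (sval y i) t (m i) by exact: svalP.
have mb i : i \notin rsupp x y -> m i = b i.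
  case/rsuppP=> xb yb; have [xm _] := dist_stewart_point (dm i) t01 (mP i).
  rewrite xb yb (metric_xx (dm i)) mulr0 in xm.
  exact/esym/(metric_eq (dm i)).
have mfin : finite_set [set i | m i <> b i].
  by apply: (sub_finite_set _ (finite_fset (rsupp x y))) => i /= mib; apply/negPn/negP => /mb.
exists (exist _ m mfin) => p; rewrite !sqr_l2dist.
pose A := (rsupp p p `|` rsupp x y)%fset.
have offA i : i \notin A ->
    [/\ sval p i = b i, sval x i = b i, sval y i = b i & m i = b i].
  by rewrite in_fsetU negb_or => /andP[/rsuppP[-> _] ixy]; have [-> ->] := rsuppP ixy; rewrite mb.
rewrite !(@l2dist2E A); try by move=> i /offA[/= ? ? ? ?]; congruence.
rewrite !mulr_sumr -big_split -sumrB /=; apply: ler_sum => i _.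
exact: mP.
Qed.

Lemma l2dist_relabel tau (phi : forall j, X (tau j) -> X j) (bij : bijective tau)
    (fin : finite_set [set j | phi j (b (tau j)) <> b j]) x y :
  (forall j u v, d (phi j u) (phi j v) = d u v) ->
  l2dist (relabel (bij_inj bij) fin x) (relabel (bij_inj bij) fin y) = l2dist x y.
Proof.
move=> iso; congr Num.sqrt; rewrite [RHS](reindex_fsbigT tau) //.
by apply: eq_fsbigr => i _ /=; rewrite iso.
Qed.

End EuclideanSum.

(** * Chains of cells *)

Section Chains.
Variables (R : realType) (K : cube_complex R).
Implicit Types (x y z : cpoint K) (l m s e : R).

(** Chains are handled one cell at a time, without naming cells and vectors. *)
Definition step x y l : Prop :=
  exists (c : cell K) (u v : 'rV[R]_(cdim c)),
    [/\ cube u, cube v, chart u = x, chart v = y & edist u v = l].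

Lemma step_ge0 x y l : step x y l -> 0 <= l.
Proof. by case=> c [u [v [_ _ _ _ <-]]]; exact: edist_ge0. Qed.

Lemma step_sym x y l : step x y l -> step y x l.
Proof.
by case=> c [u [v [cu cv ux vy <-]]]; exists c, v, u; split; rewrite // edist_sym.
Qed.

Lemma step_refl x : step x x 0.
Proof.
have [c [u cu ux]] := chart_surj x.
by exists c, u, u; split; rewrite // edist_xx.
Qed.

Lemma cube_combination n (u v : 'rV[R]_n) s : 0 <= s <= 1 -> cube u -> cube v ->
  cube ((1 - s) *: u + s *: v).
Proof.
move=> /andP[s0 s1] cu cv i; have := cu i; have := cv i.
by rewrite !mxE !ler_norml => /andP[? ?] /andP[? ?]; apply/andP; split; nra.
Qed.

Lemma step_split x y l s : 0 <= s <= 1 -> step x y l ->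
  exists z, step x z (s * l) /\ step z y ((1 - s) * l).
Proof.
move=> s01 [c [u [v [cu cv ux vy <-]]]]; have [s0 s1] := andP s01.
have cw := cube_combination s01 cu cv.
exists (chart ((1 - s) *: u + s *: v)); split.
  by exists c, u, ((1 - s) *: u + s *: v); split; rewrite // edist_combination.
exists c, ((1 - s) *: u + s *: v), v; split=> //.
have -> : (1 - s) *: u + s *: v = (1 - (1 - s)) *: v + (1 - s) *: u.
  by rewrite addrC; congr (_ *: _ + _); ring.
by rewrite edist_sym edist_combination ?subr_ge0 // edist_sym.
Qed.

Lemma chain_step x y z l m : step x y l -> chain y z m -> chain x z (l + m).
Proof. by case=> c [u [v [cu cv <- <- <-]]] ch; exact: chain_cons. Qed.

Lemma step_chain x y l : step x y l -> chain x y l.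
Proof. by move=> st; rewrite -[l]addr0; apply: chain_step st (chain_nil _). Qed.

Lemma chain_step_ind (P : cpoint K -> cpoint K -> R -> Prop) :
  (forall x, P x x 0) ->
  (forall x y z l m, step x y l -> chain y z m -> P y z m -> P x z (l + m)) ->
  forall x y l, chain x y l -> P x y l.
Proof.
move=> P0 PS x y l; elim=> [//|c u v y' l' cu cv ch IH].
by apply: PS ch IH; exists c, u, v.
Qed.

Lemma chain_ge0 x y l : chain x y l -> 0 <= l.
Proof.
move: x y l; apply: chain_step_ind => // x y z l m /step_ge0 l0 _ m0.
exact: addr_ge0.
Qed.

Lemma chain_trans x y z l m : chain x y l -> chain y z m -> chain x z (l + m).
Proof.
move=> ch; move: x y l ch z m.
apply: chain_step_ind => [x z m|x y z l m st ch IH w n cn]; first by rewrite add0r.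
by rewrite -addrA; apply: chain_step st (IH _ _ cn).
Qed.

Lemma chain_sym x y l : chain x y l -> chain y x l.
Proof.
move: x y l; apply: chain_step_ind => [x|x y z l m st _ IH]; first exact: chain_nil.
by rewrite addrC; apply: chain_trans IH (step_chain (step_sym st)).
Qed.

Lemma has_lbound_chain x y : has_lbound [set l | chain x y l].
Proof. by exists 0 => l /chain_ge0. Qed.

Lemma complex_dist_le x y l : chain x y l -> complex_dist x y <= l.
Proof. by move=> ch; apply: ge_inf => //; exact: has_lbound_chain. Qed.

Lemma complex_dist_adherent x y e : (exists l, chain x y l) -> 0 < e ->
  exists2 l, chain x y l & l <= complex_dist x y + e.
Proof.
move=> [l0 ch0] e0; have hi : has_inf [set l | chain x y l].
  by split; [exists l0 | exact: has_lbound_chain].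
by have [l ch lt] := inf_adherent e0 hi; exists l => //; exact: ltW.
Qed.

(** Lower bounds on the length metric only have to be checked inside the cells,
    since they add up along chains. *)
Lemma le_complex_dist (D : cpoint K -> cpoint K -> R) :
  (forall x y, exists l, chain x y l) ->
  (forall x, D x x <= 0) -> (forall x y z, D x z <= D x y + D y z) ->
  (forall x y l, step x y l -> D x y <= l) ->
  forall x y, D x y <= complex_dist x y.
Proof.
move=> con D0 Dt Ds x y; apply: lb_le_inf; first by have [l] := con x y; exists l.
move=> l /=; move: x y l; apply: chain_step_ind => // x y z l m st _ Dyz.
by apply: le_trans (Dt x y z) _; rewrite lerD // Ds.
Qed.

End Chains.

(** Two chains can be run simultaneously at proportional speeds: [U] pairs a
    point of [P] with a point of [K], and each pair of steps gives a step.  At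
    each stage the longer (relative to the total lengths) of the two current
    steps is cut so that both advance by the same fraction of their total
    lengths; the nested induction follows the step that gets used up. *)
Section MergeChains.
Variables (R : realType) (P K Q : cube_complex R).
Variable U : cpoint P -> cpoint K -> cpoint Q.
Hypothesis step_merge : forall x y a c (l m : R), step x y l -> step a c m ->
  exists2 k, k <= Num.sqrt (l ^+ 2 + m ^+ 2) & step (U x a) (U y c) k.

Lemma chain_merge_const x a c (l : R) : chain a c l ->
  exists2 k, k <= l & chain (U x a) (U x c) k.
Proof.
move: a c l; apply: chain_step_ind => [a|a c e l m st ch [k km chk]].
  by exists 0 => //; exact: chain_nil.
have [j jl stj] := step_merge (step_refl x) st.
exists (j + k); last exact: chain_step stj chk.
rewrite lerD //; apply: le_trans jl _.
by rewrite expr0n add0r sqrtr_sqr ger0_norm // (step_ge0 st).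
Qed.

(** Cutting the step of length [m] at the ratio [s] makes the two first steps
    proportional to the two remainders. *)
Lemma cut_fraction (l l1 m m1 : R) : 0 <= l -> 0 <= l1 -> 0 <= m -> 0 <= m1 ->
  l * m1 <= m * l1 ->
  exists2 s, 0 <= s <= 1 & l * ((1 - s) * m + m1) = s * m * l1.
Proof.
move=> l0 l10 m0 m10 le; have [z|nz] := eqVneq (m * (l + l1)) 0.
  exists 0; first by rewrite lexx ler01.
  by nra.
have pos : 0 < m * (l + l1) by rewrite lt0r nz mulr_ge0 ?addr_ge0.
exists (l * (m + m1) / (m * (l + l1))).
  rewrite divr_ge0 ?ler_pdivrMr ?mulr_ge0 ?addr_ge0 //=; nra.
by move: nz; rewrite mulf_eq0 negb_or => /andP[? ?]; field; apply/andP.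
Qed.

Lemma chain_merge x y a c (l m : R) : chain x y l -> chain a c m ->
  exists2 k, k <= Num.sqrt (l ^+ 2 + m ^+ 2) & chain (U x a) (U y c) k.
Proof.
move=> ch; move: x y l ch a c m.
apply: chain_step_ind => [x a c m cm|x v y l l1 stx chv IH a c m cm].
  have [k km chk] := chain_merge_const x cm; exists k => //.
  by rewrite expr0n add0r sqrtr_sqr ger0_norm // (chain_ge0 cm).
have l10 := chain_ge0 chv.
move: a c m cm x l stx.
apply: chain_step_ind => [a|a w c m m1 sta chw IH2] x l stx; have l0 := step_ge0 stx.
  have [j jl stj] := step_merge stx (step_refl a).
  have [k kl chk] := IH a a 0 (chain_nil _).
  exists (j + k); last exact: chain_step stj chk.
  move: jl kl; rewrite expr0n !addr0 !sqrtr_sqr !ger0_norm ?addr_ge0 //.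
  exact: lerD.
have m0 := step_ge0 sta; have m10 := chain_ge0 chw.
have [le|/ltW le] := leP (l * m1) (m * l1).
  have [s s01 e] := cut_fraction l0 l10 m0 m10 le; have [s0 s1] := andP s01.
  have [z [sz zs]] := step_split s01 sta.
  have [j jl stj] := step_merge stx sz.
  have [k kl chk] := IH _ _ _ (chain_step zs chw).
  exists (j + k); last exact: chain_step stj chk.
  apply: le_trans (lerD jl kl) _; rewrite sqrt_parallel ?addr_ge0 ?mulr_ge0 ?subr_ge0 //.
  by have -> : s * m + ((1 - s) * m + m1) = m + m1 by ring.
have le' : m * l1 <= l * m1 by [].
have [s s01 e] := cut_fraction m0 m10 l0 l10 le'; have [s0 s1] := andP s01.
have [z [sz zs]] := step_split s01 stx.
have [j jl stj] := step_merge sz sta.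
have [k kl chk] := IH2 _ _ zs.
exists (j + k); last exact: chain_step stj chk.
apply: le_trans (lerD jl kl) _.
rewrite sqrt_parallel ?addr_ge0 ?mulr_ge0 ?subr_ge0 //.
by have -> : s * l + ((1 - s) * l + l1) = l + l1 by ring.
Qed.

End MergeChains.

(** * Turning a vertex into a cell *)

(** A vertex of a complex need not be the image of a zero-dimensional cube; in an
    infinite product the base point must be one, for the cells to have finite
    dimension.  Adding such a cube changes neither the metric nor the closed
    cells. *)
Section AddVertex.
Variables (R : realType).

Lemma face_support_refl n (u : 'rV[R]_n) : cube u -> face_support u u.
Proof. by []. Qed.

(** In this form the condition is coordinatewise, hence passes to products of
    cubes and to their factors. *)
Lemma face_supportP n (u v : 'rV[R]_n) : cube u -> cube v ->
  face_support u = face_support v <-> face_support u v /\ face_support v u.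
Proof.
move=> cu cv; split=> [e|[[_ uv] [_ vu]]].
  by rewrite {1}e -{2}e; split; exact: face_support_refl.
rewrite eqEsubset; split=> w [cw h]; split=> // i hi.
  by rewrite h ?vu // -hi -vu.
by rewrite h ?uv // -hi -uv.
Qed.

Definition corner n (u : 'rV[R]_n) : Prop := forall i, `|u 0 i| = 2^-1.

Lemma corner_cube n (u : 'rV[R]_n) : corner u -> cube u.
Proof. by move=> cu i; rewrite cu. Qed.

Lemma face_support_corner n (u : 'rV[R]_n) : corner u -> face_support u = [set u].
Proof.
move=> cu; rewrite eqEsubset; split=> v /=; last by move=> ->; split=> //; exact: corner_cube.
by case=> _ vu; apply/rowP => i; exact: vu.
Qed.

Lemma set_bij_set1 T T' (S : set T) (x : T') h : set_bij S [set x] h ->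
  forall u v, S u -> S v -> u = v.
Proof.
by case=> f i _ u v Su Sv; apply: i; rewrite ?inE // (f _ Su) (f _ Sv).
Qed.

Variables (K : cube_complex R) (c0 : cell K) (v0 : 'rV[R]_(cdim c0)).
Hypothesis v0P : corner v0.

(** A face with the same image as a vertex is isometric to it. *)
Lemma face_support_vertex c (u : 'rV[R]_(cdim c)) : cube u -> chart u = chart v0 ->
  face_support u = [set u].
Proof.
move=> cu uv; have [h [hb _ _]] := gluing_isometry cu (corner_cube v0P) uv.
rewrite (face_support_corner v0P) in hb.
rewrite eqEsubset; split=> v /=; last by move=> ->; exact: face_support_refl.
by move=> uS; exact: (set_bij_set1 hb uS (face_support_refl cu)).
Qed.

Definition av_dim (c : option (cell K)) : nat := if c is Some c' then cdim c' else 0.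

Definition av_chart c : 'rV[R]_(av_dim c) -> cpoint K :=
  if c is Some c' as c return 'rV[R]_(av_dim c) -> cpoint K
  then @chart R K c' else fun=> chart v0.

Lemma av_surj x : exists c, exists2 u : 'rV[R]_(av_dim c), cube u & av_chart u = x.
Proof. by have [c [u cu ux]] := chart_surj x; exists (Some c), u. Qed.

Lemma av_inj c (u v : 'rV[R]_(av_dim c)) : cube u -> cube v ->
  face_support u = face_support v -> av_chart u = av_chart v -> u = v.
Proof.
case: c u v => [c|] u v; first exact: chart_inj.
by move=> *; apply/rowP => -[].
Qed.

Lemma face_support_row0 (u : 'rV[R]_0) : face_support u = [set u].
Proof. by apply: face_support_corner => -[]. Qed.

(** As soon as one of the two cells is the new one, both faces are points. *)
Lemma av_gluing c c' (u : 'rV[R]_(av_dim c)) (u' : 'rV[R]_(av_dim c')) :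
  cube u -> cube u' -> av_chart u = av_chart u' ->
  exists h : 'rV[R]_(av_dim c) -> 'rV[R]_(av_dim c'),
    [/\ set_bij (face_support u) (face_support u') h,
        forall v w, face_support u v -> face_support u w ->
          edist (h v) (h w) = edist v w
      & forall v, face_support u v -> av_chart v = av_chart (h v)].
Proof.
have point : face_support u = [set u] -> face_support u' = [set u'] ->
  av_chart u = av_chart u' ->
  exists h : 'rV[R]_(av_dim c) -> 'rV[R]_(av_dim c'),
    [/\ set_bij (face_support u) (face_support u') h,
        forall v w, face_support u v -> face_support u w ->
          edist (h v) (h w) = edist v w
      & forall v, face_support u v -> av_chart v = av_chart (h v)].
  move=> -> -> e; exists (fun=> u'); split.
  - split=> [v //|v w|v /= ->]; first by rewrite !inE => -> ->.
    by exists u.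
  - by move=> v w -> ->; rewrite !edist_xx.
  - by move=> v ->.
case: c c' u u' point => [c|] [c'|] u u' point cu cu' uu'.
- exact: gluing_isometry.
- apply: point => //; last exact: face_support_row0.
  exact: face_support_vertex.
- apply: point => //; first exact: face_support_row0.
  exact: face_support_vertex.
- by apply: point => //; exact: face_support_row0.
Qed.

Definition add_vertex : cube_complex R :=
  CubeComplex av_surj av_inj av_gluing.

Lemma chain_add_vertex (x y : cpoint K) (l : R) :
  @chain R add_vertex x y l <-> @chain R K x y l.
Proof.
split.
  elim=> [z|[c|] u v z m cu cv _ IH]; first exact: chain_nil.
    exact: chain_cons.
  have -> : u = v by apply/rowP => -[].
  by rewrite edist_xx add0r.
elim=> [z|c u v z m cu cv _ IH]; first exact: chain_nil.
exact: (@chain_cons R add_vertex (Some c)).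
Qed.

Lemma complex_dist_add_vertex : @complex_dist R add_vertex = @complex_dist R K.
Proof.
apply/funext => x; apply/funext => y; congr inf.
by apply/seteqP; split=> l /= /chain_add_vertex.
Qed.

Lemma closed_cell_add_vertex (S : set (cpoint K)) :
  @closed_cell R add_vertex S <-> @closed_cell R K S.
Proof.
split=> [[[c|] [u cu ->]]|[c [u cu ->]]].
- by exists c, u.
- exists c0, v0; first exact: corner_cube.
  by rewrite face_support_row0 face_support_corner // !image_set1.
- by exists (Some c), u.
Qed.

Lemma cat0_add_vertex : cat0_complex K -> cat0_complex add_vertex.
Proof.
case=> con; rewrite /cat0_complex complex_dist_add_vertex; split => // x y.
by have [l ch] := con x y; exists l; apply/chain_add_vertex.
Qed.

Lemma cellular_isometry_add_vertex (f : cpoint K -> cpoint K) :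
  cellular_isometry f -> @cellular_isometry R add_vertex f.
Proof.
case=> iso cl; split; first by rewrite complex_dist_add_vertex.
by move=> S /closed_cell_add_vertex/cl/closed_cell_add_vertex.
Qed.

End AddVertex.

(** * Restricted products of cube complexes *)

Section ProductComplex.
Variables (R : realType) (I : choiceType) (K : I -> cube_complex R).
Variable e : forall i, cell (K i).
Hypothesis e0 : forall i, cdim (e i) = 0%N.

Definition base_vertex i : cpoint (K i) := chart (0 : 'rV[R]_(cdim (e i))).

(** Almost all factors of a cell are base vertices, so that it has finite
    dimension. *)
Definition pcell := rprod e.

Lemma row_dim0 n (u v : 'rV[R]_n) : n = 0%N -> u = v.
Proof. by move=> n0; subst n; apply/rowP => -[]. Qed.

Lemma edist_dim0 n (u v : 'rV[R]_n) : n = 0%N -> edist u v = 0.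
Proof. by move=> n0; rewrite (row_dim0 u v n0) edist_xx. Qed.

Lemma chart_base i (c : cell (K i)) (u : 'rV[R]_(cdim c)) :
  c = e i -> chart u = base_vertex i.
Proof. by move=> ce; subst c; rewrite (row_dim0 u 0 (e0 i)). Qed.

Definition psupp (c : pcell) : {fset I} := fset_set [set i | sval c i <> e i].

Lemma psuppP c i : i \notin psupp c -> sval c i = e i.
Proof.
rewrite in_fset_set; last exact: finite_supp.
by rewrite notin_setE /= => /contrapT.
Qed.

(** Indexing the vectors of a product cell by a list of pairs makes their
    projections total functions of [i], including the indices where the factor
    is a vertex. *)
Definition coords (c : pcell) : seq {i : I & 'I_(cdim (sval c i))} :=
  [seq existT _ i j | i <- psupp c, j <- enum 'I_(cdim (sval c i))].

Definition pdim (c : pcell) : nat := size (coords c).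

Definition coord (c : pcell) (k : 'I_(pdim c)) : {i : I & 'I_(cdim (sval c i))} :=
  tnth (in_tuple (coords c)) k.

Lemma coords_uniq c : uniq (coords c).
Proof.
apply: allpairs_uniq_dep => [|i _|]; [exact: fset_uniq | exact: enum_uniq |].
by move=> [i j] [i' j'] _ _.
Qed.

Lemma mem_coords c s : s \in coords c.
Proof.
case: s => i j; apply/allpairsPdep; exists i, j; split; rewrite ?mem_enum //.
by apply/negPn/negP => /psuppP ce; case: j => m; rewrite ce e0.
Qed.

Lemma coord_surj c s : exists k, @coord c k = s.
Proof.
have lt : (index s (coords c) < pdim c)%N by rewrite index_mem mem_coords.
by exists (Ordinal lt); rewrite /coord (tnth_nth s) /= nth_index ?mem_coords.
Qed.

Definition value (c : pcell) (u : 'rV[R]_(pdim c)) (s : {i : I & 'I_(cdim (sval c i))}) : R :=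
  if insub (index s (coords c)) is Some k then u 0 k else 0.

Lemma value_coord c (u : 'rV[R]_(pdim c)) k : value u (coord k) = u 0 k.
Proof.
rewrite /value /coord (tnth_nth (coord k)) index_uniq ?coords_uniq //=.
by rewrite valK.
Qed.

Definition proj (c : pcell) (u : 'rV[R]_(pdim c)) i : 'rV[R]_(cdim (sval c i)) :=
  \row_j value u (existT _ i j).

Definition lift (c : pcell) (w : forall i, 'rV[R]_(cdim (sval c i))) : 'rV[R]_(pdim c) :=
  \row_k w (tag (coord k)) 0 (tagged (coord k)).

Lemma proj_coord c (u : 'rV[R]_(pdim c)) k :
  proj u (tag (coord k)) 0 (tagged (coord k)) = u 0 k.
Proof. by rewrite mxE -value_coord; case: (coord k). Qed.

Lemma proj_lift (c : pcell) (w : forall i, 'rV[R]_(cdim (sval c i))) i : proj (lift w) i = w i.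
Proof.
apply/rowP => j; rewrite mxE; have [k kE] := coord_surj (existT _ i j).
by rewrite -kE value_coord mxE kE.
Qed.

Lemma forall_coords c (P : R -> R -> Prop) (u v : 'rV[R]_(pdim c)) :
  (forall k, P (u 0 k) (v 0 k)) <-> (forall i j, P (proj u i 0 j) (proj v i 0 j)).
Proof.
split=> [h i j|h k]; last by rewrite -!proj_coord.
have [k kE] := coord_surj (existT _ i j).
by rewrite !mxE -kE !value_coord.
Qed.

Lemma proj_inj c (u v : 'rV[R]_(pdim c)) : (forall i, proj u i = proj v i) -> u = v.
Proof.
move=> uv; apply/rowP; apply/(@forall_coords c (fun a b => a = b)) => i j.
by rewrite uv.
Qed.

Lemma cube_proj c (u : 'rV[R]_(pdim c)) : cube u <-> forall i, cube (proj u i).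
Proof. exact: (@forall_coords c (fun a _ => `|a| <= 2^-1) u u). Qed.

Lemma face_support_proj c (u v : 'rV[R]_(pdim c)) :
  face_support u v <-> forall i, face_support (proj u i) (proj v i).
Proof.
have faceP := @forall_coords c (fun a b => `|a| = 2^-1 -> b = a) u v.
split=> [[/cube_proj cv /faceP h] i|h]; first by split=> // j; exact: h.
split; first by apply/cube_proj => i; case: (h i).
by apply/faceP => i j; have [_] := h i; exact.
Qed.

Lemma fsum_fset (A : {fset I}) (f : I -> R) : (forall i, i \notin A -> f i = 0) ->
  \sum_(i \in [set: I]) f i = \sum_(i <- A) f i.
Proof.
move=> fA; rewrite -(fsbig_widen [set` A]) //.
  by rewrite -fsbig_seq // fset_uniq.
by move=> i [_ /= /negP iA]; rewrite fA.
Qed.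

Lemma sqr_edist_proj c (u v : 'rV[R]_(pdim c)) :
  edist u v ^+ 2 = \sum_(i \in [set: I]) edist (proj u i) (proj v i) ^+ 2.
Proof.
rewrite (@fsum_fset (psupp c)); last first.
  by move=> i /psuppP ce; rewrite edist_dim0 ?expr0n // ce.
rewrite sqr_edist.
under eq_bigr => k _ do rewrite -[u 0 k]value_coord -[v 0 k]value_coord.
rewrite -(big_tnth _ _ (coords c) xpredT (fun s => (value u s - value v s) ^+ 2)).
rewrite big_allpairs_dep; apply: eq_bigr => i _.
by rewrite sqr_edist big_enum /=; apply: eq_bigr => j _; rewrite !mxE.
Qed.

Lemma finite_pchart c (u : 'rV[R]_(pdim c)) :
  finite_set [set i | chart (proj u i) <> base_vertex i].
Proof.
apply: sub_finite_set (finite_supp c) => i /= ne ce; apply: ne.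
exact: chart_base.
Qed.

Definition pchart c (u : 'rV[R]_(pdim c)) : rprod base_vertex :=
  exist _ (fun i => chart (proj u i)) (finite_pchart u).

(** Cells of the product are found factor by factor; the base vertex is chosen
    wherever it may be, so that the cells found form a cell of the product. *)
Lemma choose_cell (P : forall i (c : cell (K i)), 'rV[R]_(cdim c) -> 'rV[R]_(cdim c) -> Prop) :
  (forall i, exists c u v, P i c u v) ->
  finite_set [set i | ~ P i (e i) 0 0] ->
  exists c (u v : 'rV[R]_(pdim c)), forall i, P i (sval c i) (proj u i) (proj v i).
Proof.
move=> ex fin.
have ex' i : exists s : {c : cell (K i) & ('rV[R]_(cdim c) * 'rV[R]_(cdim c))%type},
    P i (tag s) (tagged s).1 (tagged s).2 /\ (P i (e i) 0 0 -> tag s = e i).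
  have [Pe|nPe] := pselect (P i (e i) 0 0).
    by exists (existT _ (e i) (0, 0)).
  by have [c [u [v Pc]]] := ex i; exists (existT _ c (u, v)).
pose s i := sval (cid (ex' i)).
have sP i : P i (tag (s i)) (tagged (s i)).1 (tagged (s i)).2.
  by have [] := svalP (cid (ex' i)).
have se i : P i (e i) 0 0 -> tag (s i) = e i.
  by have [] := svalP (cid (ex' i)).
have cfin : finite_set [set i | tag (s i) <> e i].
  by apply: sub_finite_set fin => i /= ne /se.
pose c : pcell := exist _ (fun i => tag (s i)) cfin.
exists c, (@lift c (fun i => (tagged (s i)).1)), (@lift c (fun i => (tagged (s i)).2)).
by move=> i; rewrite !proj_lift; exact: sP.
Qed.

Lemma cube_dim0 n (u : 'rV[R]_n) : n = 0%N -> cube u.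
Proof. by move=> n0; subst n; case. Qed.

Lemma pchart_surj (x : rprod base_vertex) :
  exists c, exists2 u : 'rV[R]_(pdim c), cube u & pchart u = x.
Proof.
have [i||c [u [_ h]]] := @choose_cell (fun i c u _ => cube u /\ chart u = sval x i).
- by have [c [u cu ux]] := chart_surj (sval x i); exists c, u, u.
- apply: sub_finite_set (finite_supp x) => i /= ne xb; apply: ne.
  by rewrite xb; split=> //; exact/cube_dim0/e0.
exists c, u; first by apply/cube_proj => i; case: (h i).
by apply: rprod_eq => i /=; case: (h i).
Qed.

Lemma pchart_inj c (u v : 'rV[R]_(pdim c)) : cube u -> cube v ->
  face_support u = face_support v -> pchart u = pchart v -> u = v.
Proof.
move=> cu cv /(face_supportP cu cv)[/face_support_proj uv /face_support_proj vu] e_uv.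
apply: proj_inj => i; move: (cu) (cv) => /cube_proj cui /cube_proj cvi.
apply: chart_inj => //; first by apply/face_supportP.
by have /(congr1 (fun x => sval x i)) := e_uv.
Qed.

Lemma pchart_gluing c c' (u : 'rV[R]_(pdim c)) (u' : 'rV[R]_(pdim c')) :
  cube u -> cube u' -> pchart u = pchart u' ->
  exists h : 'rV[R]_(pdim c) -> 'rV[R]_(pdim c'),
    [/\ set_bij (face_support u) (face_support u') h,
        forall v w, face_support u v -> face_support u w ->
          edist (h v) (h w) = edist v w
      & forall v, face_support u v -> pchart v = pchart (h v)].
Proof.
move=> /cube_proj cu /cube_proj cu' uu'.
have glue i : chart (proj u i) = chart (proj u' i).
  by have /(congr1 (fun x => sval x i)) := uu'.
pose hi i := sval (cid (gluing_isometry (cu i) (cu' i) (glue i))).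
have hP i := svalP (cid (gluing_isometry (cu i) (cu' i) (glue i))).
exists (fun v => lift (fun i => hi i (proj v i))); split.
- split.
  + move=> v /face_support_proj uv; apply/face_support_proj => i.
    by rewrite proj_lift; have [[+ _ _] _ _] := hP i; apply.
  + move=> v w; rewrite !inE => /face_support_proj uv /face_support_proj uw vw.
    apply: proj_inj => i; have [[_ inj _] _ _] := hP i.
    apply: inj; rewrite ?inE //.
    by have := congr1 (@proj c' ^~ i) vw; rewrite /= !proj_lift.
  + move=> v' /face_support_proj uv'.
    have ex i : exists v, face_support (proj u i) v /\ hi i v = proj v' i.
      by have [[_ _ s] _ _] := hP i; have [v ? ?] := s _ (uv' i); exists v.
    exists (lift (fun i => sval (cid (ex i)))).
      by apply/face_support_proj => i; rewrite proj_lift; case: cid => v [].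
    by apply: proj_inj => i; rewrite !proj_lift; case: cid => v [].
- move=> v w /face_support_proj uv /face_support_proj uw; apply/eqP.
  rewrite -(@eqrXn2 _ 2) ?edist_ge0 // !sqr_edist_proj; apply/eqP.
  apply: eq_fsbigr => i _; rewrite !proj_lift.
  by have [_ -> //] := hP i.
- move=> v /face_support_proj uv; apply: rprod_eq => i /=; rewrite proj_lift.
  by have [_ _ ->] := hP i.
Qed.

Definition product_complex : cube_complex R :=
  CubeComplex pchart_surj pchart_inj pchart_gluing.

Local Notation PK := product_complex.

Lemma step_proj (x y : cpoint PK) (l : R) : @step R PK x y l ->
  exists li : I -> R, [/\ forall i, step (sval x i) (sval y i) (li i),
    finite_set [set i | li i <> 0] & l ^+ 2 = \sum_(i \in [set: I]) li i ^+ 2].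
Proof.
case=> c [u [v [/cube_proj cu /cube_proj cv <- <- <-]]].
exists (fun i => edist (proj u i) (proj v i)); split; last exact: sqr_edist_proj.
  by move=> i; exists (sval c i), (proj u i), (proj v i).
apply: sub_finite_set (finite_supp c) => i /= ne ce; apply: ne.
by rewrite edist_dim0 // ce.
Qed.

Lemma step_product (x y : cpoint PK) (li : I -> R) :
  (forall i, step (sval x i) (sval y i) (li i)) ->
  finite_set [set i | li i <> 0] ->
  @step R PK x y (Num.sqrt (\sum_(i \in [set: I]) li i ^+ 2)).
Proof.
move=> st fin.
have [i||c [u [v h]]] := @choose_cell (fun i c u v => [/\ cube u, cube v,
  chart u = sval x i, chart v = sval y i & edist u v = li i]).
- exact: st.
- apply: (@sub_finite_set _ _ ([set i | sval x i <> base_vertex i] `|`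
    ([set i | sval y i <> base_vertex i] `|` [set i | li i <> 0]))); last first.
    by rewrite !finite_setU; split; [|split] => //; exact: finite_supp.
  move=> i /= ne; apply: contrapT => /not_orP[/contrapT xb] /not_orP[/contrapT yb].
  move=> /contrapT l0; apply: ne; rewrite xb yb l0 edist_xx.
  by split=> //; apply/cube_dim0/e0.
exists c, u, v; split.
- by apply/cube_proj => i; case: (h i).
- by apply/cube_proj => i; case: (h i).
- by apply: rprod_eq => i /=; case: (h i).
- by apply: rprod_eq => i /=; case: (h i).
apply/eqP; rewrite -(@eqrXn2 _ 2) ?edist_ge0 ?sqrtr_ge0 // [eqbRHS]sqr_sqrtr; last first.
  by rewrite fsumr_ge0 // => i _; exact: sqr_ge0.
by rewrite sqr_edist_proj; apply/eqP/eq_fsbigr => i _; case: (h i) => _ _ _ _ ->.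
Qed.

(** The new step replaces the [j]-th component of the first one by the second
    one, hence the inequality. *)
Lemma step_upd j (x y : cpoint PK) (a c : cpoint (K j)) (l m : R) :
  @step R PK x y l -> step a c m ->
  exists2 k, k <= Num.sqrt (l ^+ 2 + m ^+ 2) &
    @step R PK (upd (x : rprod base_vertex) a) (upd (y : rprod base_vertex) c) k.
Proof.
move=> /step_proj[li [st fin lE]] sta.
pose li' i := if j == i then m else li i.
have fin' : finite_set [set i | li' i <> 0].
  apply: (@sub_finite_set _ _ ([set i | li i <> 0] `|` [set j])); last first.
    by rewrite finite_setU; split => //; exact: finite_set1.
  by move=> i /=; rewrite /li'; case: eqP => [->|_ ?]; [right | left].
exists (Num.sqrt (\sum_(i \in [set: I]) li' i ^+ 2)); last first.
  apply: step_product => // i; rewrite /li'; have [<-|ne] := eqVneq j i.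
    by rewrite !upd_in.
  by rewrite !upd_out.
rewrite ler_sqrt; last by rewrite addr_ge0 ?sqr_ge0.
pose A := (j |` fset_set [set i | li i <> 0])%fset.
have liA i : i \notin A -> li i = 0.
  rewrite in_fset1U negb_or => /andP[_]; rewrite in_fset_set // notin_setE /=.
  exact: contrapT.
rewrite lE !(@fsum_fset A); last 2 first.
- by move=> i /liA ->; rewrite expr0n.
- move=> i iA; rewrite /li' liA //; case: eqP => [ji|_]; last by rewrite expr0n.
  by move: iA; rewrite -ji fset1U1.
rewrite (big_fsetD1 j) ?fset1U1 //= [X in _ <= X + _](big_fsetD1 j) ?fset1U1 //=.
rewrite /li' eqxx addrC lerD2r.
rewrite (eq_big_seq (fun i => li i ^+ 2)); first by rewrite lerDr sqr_ge0.
by move=> i; rewrite in_fsetD1 eq_sym => /andP[/negPf ->].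
Qed.

(** One coordinate is added at a time: a chain that leaves the coordinate [j]
    unchanged is merged with a chain of the factor [j]. *)
Lemma chain_product (A : seq I) (li : I -> R) (x y : cpoint PK) : uniq A ->
  (forall i, i \notin A -> sval x i = sval y i) ->
  (forall i, i \in A -> chain (sval x i) (sval y i) (li i)) ->
  exists2 k, k <= Num.sqrt (\sum_(i <- A) li i ^+ 2) & @chain R PK x y k.
Proof.
elim: A y => [|j A IH] y /=.
  move=> _ xy _; exists 0; first exact: sqrtr_ge0.
  have -> : x = y by apply: rprod_eq => i; exact: xy.
  exact: chain_nil.
move=> /andP[jA uA] xy ch.
pose y' : rprod base_vertex := upd (y : rprod base_vertex) (sval x j).
have [||k kl chk] := IH y' uA.
- move=> i iA; have [<-|ne] := eqVneq j i; first by rewrite upd_in.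
  by rewrite upd_out // xy // inE eq_sym negb_or ne.
- move=> i iA; rewrite upd_out; first by apply: ch; rewrite inE iA orbT.
  by apply: contraNneq jA => ->.
have [m ml chm] := chain_merge (@step_upd j) chk (ch j (mem_head _ _)).
have xE : upd (x : rprod base_vertex) (sval x j) = x.
  apply: rprod_eq => i; have [<-|ne] := eqVneq j i; first by rewrite upd_in.
  by rewrite upd_out.
have yE : upd y' (sval y j) = y.
  apply: rprod_eq => i; have [<-|ne] := eqVneq j i; first by rewrite upd_in.
  by rewrite !upd_out.
rewrite xE yE in chm; exists m => //; apply: le_trans ml _.
have sum0 : 0 <= \sum_(i <- A) li i ^+ 2.
  by rewrite sumr_ge0 // => i _; exact: sqr_ge0.
rewrite big_cons ler_sqrt; last by rewrite addr_ge0 ?sqr_ge0.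
rewrite addrC lerD2l -(sqr_sqrtr sum0) lerXn2r ?nnegrE ?sqrtr_ge0 //.
exact: chain_ge0 chk.
Qed.

Section Metric.
Hypothesis catK : forall i, cat0_complex (K i).
Local Notation d i := (@complex_dist R (K i)).

Lemma factor_metric i : is_metric (d i).
Proof. by have [_ []] := catK i. Qed.

Lemma product_connected (x y : cpoint PK) : exists l, @chain R PK x y l.
Proof.
have ex i := cid ((catK i).1 (sval x i) (sval y i)).
have [|i _|k _ ch] := @chain_product (rsupp x y) (fun i => sval (ex i)) x y (fset_uniq _).
- by move=> i /rsuppP[-> ->].
- exact: svalP.
by exists k.
Qed.

(** The lower bound is checked in each cell, where the metric is the Euclidean
    sum.  For the upper bound, chains of the factors that are shortest up to a
    small error are run simultaneously. *)
Lemma complex_dist_product : @complex_dist R PK = l2dist (fun i => d i).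
Proof.
have l2m := l2dist_metric base_vertex factor_metric.
apply/funext => x; apply/funext => y; apply: le_anti; apply/andP; split; last first.
  apply: le_complex_dist; first exact: product_connected.
  - by move=> z; rewrite (metric_xx l2m).
  - by move=> ? ? ?; exact: metric_tri.
  move=> {}x {}y l st; have [li [sti fin lE]] := step_proj st.
  apply: ler_of_sqr; first exact: step_ge0 st.
  pose A := (rsupp x y `|` fset_set [set i | li i <> 0])%fset.
  have offA i : i \notin A -> sval x i = sval y i /\ li i = 0.
    rewrite in_fsetU negb_or => /andP[/rsuppP[-> ->]].
    by rewrite in_fset_set // notin_setE /= => /contrapT ->.
  rewrite sqr_l2dist lE (@fsum_fset A); last by move=> i /offA[_ ->]; rewrite expr0n.
  rewrite (l2dist2E factor_metric (A := A)); last by move=> i /offA[].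
  apply: ler_sum => i _; rewrite lerXn2r ?nnegrE ?(step_ge0 (sti i)) //.
    exact: metric_ge0 (factor_metric i) _ _.
  exact: complex_dist_le (step_chain (sti i)).
apply/ler_addgt0Pr => eps eps0.
(* Errors of [eps / (C + 1)] in each coordinate add up to less than [eps], as
   [C] is the norm of the vector of ones. *)
pose A := rsupp x y; pose C := Num.sqrt (\sum_(i <- A) (1 : R) ^+ 2).
have C0 : 0 < C + 1 by rewrite ltr_wpDl ?sqrtr_ge0.
have del0 : 0 < eps / (C + 1) by rewrite divr_gt0.
have ex i := cid2 (complex_dist_adherent ((catK i).1 (sval x i) (sval y i)) del0).
pose li i := s2val (ex i).
have [|i _|k kl ch] := @chain_product A li x y (fset_uniq _).
- by move=> i /rsuppP[-> ->].
- exact: s2valP.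
apply: le_trans (complex_dist_le ch) _; apply: le_trans kl _.
have le1 : Num.sqrt (\sum_(i <- A) li i ^+ 2) <=
    Num.sqrt (\sum_(i <- A) (d i (sval x i) (sval y i) + eps / (C + 1)) ^+ 2).
  rewrite ler_sqrt; last by rewrite sumr_ge0 // => i _; exact: sqr_ge0.
  apply: ler_sum => i _; have chi : chain _ _ (li i) := s2valP (ex i).
  rewrite lerXn2r ?nnegrE ?(chain_ge0 chi) //; last exact: (s2valP' (ex i)).
  by rewrite addr_ge0 ?(ltW del0) // (metric_ge0 (factor_metric i)).
apply: le_trans le1 _; apply: le_trans (minkowski_seq _ _ _) _.
rewrite /l2dist (l2dist2E factor_metric (A := A)); last by move=> i /rsuppP[-> ->].
rewrite lerD2l.
have -> : \sum_(i <- A) (eps / (C + 1)) ^+ 2 = (eps / (C + 1)) ^+ 2 * \sum_(i <- A) (1 : R) ^+ 2.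
  by rewrite mulr_sumr; apply: eq_bigr => i _; rewrite expr1n mulr1.
rewrite sqrtrM ?sqr_ge0 // sqrtr_sqr gtr0_norm // -/C.
by rewrite -mulrA ger_pMr // mulrC ler_pdivrMr // mul1r lerDl.
Qed.

Lemma product_cat0 : cat0_complex PK.
Proof.
split; first exact: product_connected.
rewrite complex_dist_product; apply: cat0_of_stewart.
  exact: (l2dist_metric base_vertex factor_metric).
apply: (stewart_l2dist factor_metric) => i.
by apply: stewart_of_cat0; [exact: factor_metric | have [] := catK i].
Qed.

End Metric.

Lemma face_base i (u : 'rV[R]_(cdim (e i))) :
  (@chart R (K i) (e i)) @` face_support u = [set base_vertex i].
Proof.
rewrite face_support_corner; last first.
  by move=> j; have /negP[] := negbT (ltn0 j); rewrite -[X in (_ < X)%N](e0 i).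
by rewrite image_set1 (chart_base u).
Qed.

Lemma closed_cell_product (S : set (cpoint PK)) :
  @closed_cell R PK S <-> exists Si : forall i, set (cpoint (K i)),
    [/\ forall i, closed_cell (Si i), finite_set [set i | Si i <> [set base_vertex i]]
      & S = [set x | forall i, Si i (sval x i)]].
Proof.
split=> [[c [u /cube_proj cu ->]]|[Si [cl fin ->]]].
  exists (fun i => (@chart R (K i) (sval c i)) @` face_support (proj u i)); split.
  - by move=> i; exists (sval c i), (proj u i).
  - apply: sub_finite_set (finite_supp c) => i /= ne ce; apply: ne.
    by move: (proj u i); rewrite ce => w; exact: face_base.
  - apply/seteqP; split=> [x /= [v /face_support_proj uv <-] i|x /= h].
      by exists (proj v i).
    have ex i : exists v, face_support (proj u i) v /\ chart v = sval x i.
      by have [v ? ?] := h i; exists v.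
    exists (lift (fun i => sval (cid (ex i)))).
      by apply/face_support_proj => i; rewrite proj_lift; case: cid => v [].
    by apply: rprod_eq => i /=; rewrite proj_lift; case: cid => v [].
have [i||c [u [_ h]]] := @choose_cell (fun i c u _ =>
  cube u /\ Si i = (@chart R (K i) c) @` face_support u).
- by have [c [u ? ?]] := cl i; exists c, u, u.
- apply: sub_finite_set fin => i /= ne Sb; apply: ne.
  by rewrite Sb face_base; split=> //; exact/cube_dim0/e0.
exists c, u; first by apply/cube_proj => i; case: (h i).
apply/seteqP; split=> [x /= xS|x /= [v /face_support_proj uv <-] i]; last first.
  by have [_ ->] := h i; exists (proj v i).
have ex i : exists v, face_support (proj u i) v /\ chart v = sval x i.
  by have := xS i; have [_ ->] := h i => -[v ? ?]; exists v.
exists (lift (fun i => sval (cid (ex i)))).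
  by apply/face_support_proj => i; rewrite proj_lift; case: cid => v [].
by apply: rprod_eq => i /=; rewrite proj_lift; case: cid => v [].
Qed.

(** Surjectivity of [tau] lifts a point of the image cell, factor by factor; the
    lift is at the base point almost everywhere because its cell is. *)
Lemma cellular_relabel tau
    (phi : forall j, cpoint (K (tau j)) -> cpoint (K j)) (bij : bijective tau)
    (fin : finite_set [set j | phi j (base_vertex (tau j)) <> base_vertex j]) :
  (forall i, cat0_complex (K i)) ->
  (forall j u v, complex_dist (phi j u) (phi j v) = complex_dist u v) ->
  (forall j S, closed_cell S -> closed_cell (phi j @` S)) ->
  @cellular_isometry R PK (relabel (bij_inj bij) fin).
Proof.
move=> catK iso cl; split=> [x y|S].
  by rewrite complex_dist_product //; exact: l2dist_relabel.
move=> /closed_cell_product[Si [Scl Sfin ->]]; apply/closed_cell_product.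
exists (fun j => phi j @` Si (tau j)); split.
- by move=> j; exact: cl.
- apply: (@sub_finite_set _ _ ([set j | phi j (base_vertex (tau j)) <> base_vertex j]
    `|` tau @^-1` [set i | Si i <> [set base_vertex i]])).
    move=> j /= ne; have [Sb|] := pselect (Si (tau j) = [set base_vertex (tau j)]).
      by left=> pb; apply: ne; rewrite Sb image_set1 pb.
    by right.
  rewrite finite_setU; split=> //.
  exact: finite_preimage (in2W (bij_inj bij)) Sfin.
apply/seteqP; split=> [y /= [x xS <-] j|y /= yS]; first by exists (sval x (tau j)).
have ex j : exists z, Si (tau j) z /\ phi j z = sval y j.
  by have [z ? ?] := yS j; exists z.
have [x xE] := @unrelabel I (fun i => cpoint (K i)) tau
  (fun j => sval (cid (ex j))) bij.
have xS i : Si i (x i).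
  have [rho _ rhoK] := bij; rewrite -(rhoK i) xE.
  by case: cid => z [].
have xfin : finite_set [set i | x i <> base_vertex i].
  apply: sub_finite_set Sfin => i /= ne Sb; apply: ne.
  by have := xS i; rewrite Sb.
exists (exist _ x xfin : rprod base_vertex) => //.
by apply: rprod_eq => j /=; rewrite xE; case: cid => z [].
Qed.

End ProductComplex.

(** * The tree of ends of lamp configurations *)

(** A point of the tree is a height [r] together with the germ at infinity of a
    lamp configuration, namely its values at the integers [i > r - 1].  Going up
    forgets values, so that the tree is rooted at the end [+oo] of the line; the
    germ is represented by the configuration that is trivial elsewhere. *)
Section Tree.
Variables (R : realType) (H : groupType).
Local Notation W := (wreathZ H).
Implicit Types (f g : lamps H) (r s t : R).

Definition tree_point :=
  {p : lamps H * R | forall i : int, (i + 1)%:~R <= p.2 -> p.1 i = 1%g}.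

Implicit Types x y z p : tree_point.

Definition germ x : lamps H := (sval x).1.
Definition height x : R := (sval x).2.

Lemma germ_low x (i : int) : (i + 1)%:~R <= height x -> germ x i = 1%g.
Proof. exact: (svalP x). Qed.

Definition lamps_above f r : lamps H :=
  [fsfun i in finsupp f => if r < (i + 1)%:~R then f i else 1%g].

Lemma lamps_aboveE f r (i : int) :
  lamps_above f r i = if r < (i + 1)%:~R then f i else 1%g.
Proof.
rewrite fsfun_fun; case: ifPn => // fi.
by rewrite fsfun_dflt // if_same.
Qed.

Lemma lamps_above_low f r (i : int) :
  (i + 1)%:~R <= (lamps_above f r, r).2 -> (lamps_above f r, r).1 i = 1%g.
Proof. by rewrite /= lamps_aboveE leNgt => /negPf ->. Qed.

Definition tpoint f r : tree_point := 
  exist _ (lamps_above f r, r) (@lamps_above_low f r).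

Lemma germ_tpoint f r (i : int) : r < (i + 1)%:~R -> germ (tpoint f r) i = f i.
Proof. by rewrite /germ /= lamps_aboveE => ->. Qed.

Lemma tree_point_eq x y : height x = height y ->
  (forall i : int, height x < (i + 1)%:~R -> germ x i = germ y i) -> x = y.
Proof.
move=> hxy gxy; have gE : germ x = germ y.
  apply/fsfunP => i; have [lo|/gxy//] := leP (i + 1)%:~R (height x).
  by rewrite !germ_low // -hxy.
case: x y hxy gE {gxy} => [[f r] fP] [[g s] gP]; rewrite /height /germ /= => rs fg.
by apply: eq_exist; rewrite rs fg.
Qed.

Lemma tpoint_eq f g r s : r = s ->
  (forall i : int, r < (i + 1)%:~R -> f i = g i) -> tpoint f r = tpoint g s.
Proof.
move=> <- fg; apply: tree_point_eq => // i ri.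
by rewrite !germ_tpoint // fg.
Qed.

Lemma tpointK x : tpoint (germ x) (height x) = x.
Proof. by apply: tree_point_eq => // i; exact: germ_tpoint. Qed.

Definition up r x : tree_point := tpoint (germ x) r.

Lemma height_up r x : height (up r x) = r.
Proof. by []. Qed.

Lemma up_up r s x : r <= s -> up s (up r x) = up s x.
Proof.
move=> rs; apply: tpoint_eq => // i si; apply: germ_tpoint.
exact: le_lt_trans rs si.
Qed.

(** The height of the point where the rays going up from [x] and [y] merge. *)
Definition merge_height x y : R :=
  foldr (fun i : int => Num.max (i + 1)%:~R) (Num.max (height x) (height y))
    [seq i <- finsupp (germ x) ++ finsupp (germ y) | germ x i != germ y i].

(** The only access to the definition: identities between merging heights are
    proved by comparing their upper bounds. *)
Lemma merge_height_le x y r :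
  merge_height x y <= r <-> [/\ height x <= r, height y <= r &
    forall i : int, r < (i + 1)%:~R -> germ x i = germ y i].
Proof.
have foldP (s : seq int) (m : R) :
    foldr (fun i : int => Num.max (i + 1)%:~R) m s <= r <->
    m <= r /\ {in s, forall i : int, (i + 1)%:~R <= r}.
  elim: s => [|j s IH] /=; first by split=> [//|[]].
  rewrite ge_max; split=> [/andP[jr /IH[mr sr]]|[mr sr]].
    by split=> // i; rewrite inE => /orP[/eqP->//|/sr].
  rewrite sr ?mem_head //=; apply/IH; split=> // i si.
  by apply: sr; rewrite inE si orbT.
rewrite foldP ge_max; split=> [[/andP[xr yr] sr]|[xr yr sr]].
  split=> // i ri; apply/eqP/negPn/negP => ne.
  have : (i + 1)%:~R <= r; last by rewrite leNgt ri.
  apply: sr; rewrite mem_filter ne mem_cat.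
  apply: contraNT ne; rewrite negb_or => /andP[xi yi].
  by rewrite !fsfun_dflt.
split; first by rewrite xr.
move=> i; rewrite mem_filter => /andP[ne _]; rewrite leNgt; apply: contra ne => ri.
by rewrite sr.
Qed.

Lemma height_merge x y : height x <= merge_height x y /\ height y <= merge_height x y.
Proof. by have /merge_height_le[] := lexx (merge_height x y). Qed.

Lemma germ_merge x y (i : int) :
  merge_height x y < (i + 1)%:~R -> germ x i = germ y i.
Proof. by have /merge_height_le[_ _] := lexx (merge_height x y); apply. Qed.

Lemma merge_height_eq x y r :
  (forall s, merge_height x y <= s <-> r <= s) -> merge_height x y = r.
Proof. by move=> h; apply: le_anti; apply/andP; split; apply/h. Qed.

Lemma merge_height_refl x : merge_height x x = height x.
Proof.
by apply: merge_height_eq => s; rewrite merge_height_le; split=> [[]|].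
Qed.

Lemma merge_height_sym x y : merge_height x y = merge_height y x.
Proof.
apply: merge_height_eq => s; rewrite merge_height_le.
by split=> [[? ? h]|/merge_height_le[? ? h]]; [apply/merge_height_le|];
  split=> // i /h.
Qed.

Lemma merge_height_ultra x y z :
  merge_height x z <= Num.max (merge_height x y) (merge_height y z).
Proof.
have [hx _] := height_merge x y; have [_ hz] := height_merge y z.
apply/merge_height_le; split.
- by rewrite le_max hx.
- by rewrite le_max hz orbT.
by move=> i; rewrite gt_max => /andP[/germ_merge -> /germ_merge].
Qed.

Lemma merge_height_up r x p : height x <= r ->
  merge_height p (up r x) = Num.max r (merge_height p x).
Proof.
move=> xr; apply: merge_height_eq => s; rewrite ge_max merge_height_le.
split=> [[ps rs h]|/andP[rs /merge_height_le[ps _ h]]].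
  rewrite [r <= s]rs; apply/merge_height_le; split=> //.
    exact: le_trans xr rs.
  by move=> i si; rewrite h // germ_tpoint // (le_lt_trans rs).
split=> // i si; rewrite germ_tpoint ?(le_lt_trans rs) //; exact: h.
Qed.

Definition tree_dist x y : R := 2 * merge_height x y - height x - height y.

Lemma tree_dist_metric : is_metric tree_dist.
Proof.
split=> [x y|x y|x y z]; rewrite /tree_dist.
- have [hx hy] := height_merge x y; split=> [d0|->]; last first.
    by rewrite merge_height_refl; ring.
  have xJ : height x = merge_height x y by lra.
  apply: tree_point_eq => [|i]; first by lra.
  by rewrite xJ; exact: germ_merge.
- by rewrite merge_height_sym; ring.
- have [_ y1] := height_merge x y; have [y2 _] := height_merge y z.
  have := merge_height_ultra x y z; rewrite le_max => /orP[] ?; lra.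
Qed.

(** A point on a geodesic of a tree separates any third point from one of the
    ends. *)
Lemma tree_dist_leg x y s p : 0 <= s <= merge_height x y - height x ->
  let m := up (height x + s) x in
  tree_dist p x = tree_dist p m + s \/
  tree_dist p y = tree_dist p m + (tree_dist x y - s).
Proof.
move=> /andP[s0 sJ] m; rewrite /tree_dist {}/m merge_height_up ?lerDl //.
rewrite height_up.
have [le|gt] := leP (height x + s) (merge_height p x); [left|right].
  by lra.
suff -> : merge_height p y = merge_height x y by lra.
have gtJ : merge_height p x < merge_height x y.
  by apply: lt_le_trans gt _; lra.
apply: le_anti; apply/andP; split.
  have := merge_height_ultra p x y; rewrite le_max => /orP[le|//].
  by apply: le_trans le (ltW gtJ).
have := merge_height_ultra x p y; rewrite (merge_height_sym x p).
by rewrite le_max => /orP[|//]; rewrite leNgt gtJ.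
Qed.

(** The case where [p] reaches [x] through [m]: then [p], [x] and [y] are no
    closer than points of a line at the positions [D], [- t * d] and
    [(1 - t) * d], and [m] is at the origin. *)
Lemma stewart_line (D A B d t : R) : 0 <= t <= 1 -> A = D + t * d ->
  - B <= D - (1 - t) * d -> D - (1 - t) * d <= B ->
  D ^+ 2 <= (1 - t) * A ^+ 2 + t * B ^+ 2 - t * (1 - t) * d ^+ 2.
Proof.
move=> /andP[t0 t1] -> lo hi.
have sq : (D - (1 - t) * d) ^+ 2 <= B ^+ 2 by nra.
by have := ler_wpM2l t0 sq; lra.
Qed.

(** Stating the conclusion for both orders of the ends reduces every ratio to
    points on the first leg. *)
Lemma stewart_leg x y s t : 0 <= t <= 1 -> s = t * tree_dist x y ->
  s <= merge_height x y - height x ->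
  exists m, stewart_point tree_dist x y t m /\ stewart_point tree_dist y x (1 - t) m.
Proof.
have dm := tree_dist_metric; have d0 := metric_ge0 dm x y.
move=> t01 sE sJ; have [t0 t1] := andP t01.
have s0 : 0 <= s by rewrite sE mulr_ge0.
have leg p := tree_dist_leg p (introT andP (conj s0 sJ)); move: leg => /=.
set m := up _ x => leg.
have mx : tree_dist m x = s.
  rewrite (metric_sym dm) /tree_dist {1}/m merge_height_up ?lerDl //.
  by rewrite merge_height_refl max_l ?lerDl // height_up; ring.
have my : tree_dist m y = tree_dist x y - s.
  rewrite (metric_sym dm) {1}/tree_dist {1}/m merge_height_up ?lerDl //.
  rewrite (merge_height_sym y x) max_r; last by lra.
  by rewrite height_up /tree_dist; ring.
have main p : tree_dist p m ^+ 2 <= (1 - t) * tree_dist p x ^+ 2 +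
    t * tree_dist p y ^+ 2 - t * (1 - t) * tree_dist x y ^+ 2.
  have pmx := metric_tri dm m p x; have pxm := metric_tri dm x p m.
  have pmy := metric_tri dm m p y; have pym := metric_tri dm y p m.
  have mpx := metric_tri dm p m x; have mpy := metric_tri dm p m y.
  rewrite (metric_sym dm x m) mx in pxm; rewrite (metric_sym dm y m) my in pym.
  rewrite mx (metric_sym dm m p) in mpx; rewrite my (metric_sym dm m p) in mpy.
  have [|] := leg p => e.
    by apply: stewart_line => //; lra.
  have t01' : 0 <= 1 - t <= 1 by apply/andP; lra.
  have h : tree_dist p m ^+ 2 <= (1 - (1 - t)) * tree_dist p y ^+ 2 +
      (1 - t) * tree_dist p x ^+ 2 - (1 - t) * (1 - (1 - t)) * tree_dist x y ^+ 2.
    by apply: stewart_line => //; lra.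
  by lra.
exists m; split=> p; first exact: main.
by have := main p; rewrite (metric_sym dm y x); lra.
Qed.

Lemma stewart_tree : stewart tree_dist.
Proof.
have dm := tree_dist_metric.
move=> x y t t01; have [t0 t1] := andP t01.
have [le|gt] := leP (t * tree_dist x y) (merge_height x y - height x).
  by have [m []] := stewart_leg t01 erefl le; exists m.
have t01' : 0 <= 1 - t <= 1 by apply/andP; lra.
have le : (1 - t) * tree_dist y x <= merge_height y x - height y.
  by move: gt; rewrite /tree_dist (merge_height_sym y x); lra.
have [m [_ mP]] := stewart_leg t01' erefl le.
by exists m; have -> : t = 1 - (1 - t) by ring.
Qed.

(** The cell [(f, n)] is the edge between the heights [n] and [n + 1] below the
    germ of [f]; distinct configurations may name the same edge. *)
Definition tree_height (n : int) (u : 'rV[R]_1) : R := n%:~R + 2^-1 + u 0 0.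

Definition tree_chart (c : lamps H * int) (u : 'rV[R]_1) : tree_point :=
  tpoint c.1 (tree_height c.2 u).

Lemma edist_row1 (u v : 'rV[R]_1) : edist u v = `|u 0 0 - v 0 0|.
Proof. by rewrite /edist big_ord1 sqrtr_sqr. Qed.

Lemma cube_row1 (u : 'rV[R]_1) : cube u <-> - 2^-1 <= u 0 0 <= 2^-1.
Proof. by rewrite -ler_norml; split=> [//|u1 i]; rewrite ord1. Qed.

Lemma tree_chart_at (c : lamps H * int) r : c.2%:~R <= r <= c.2%:~R + 1 ->
  exists2 u, cube u & tree_chart c u = tpoint c.1 r /\ u 0 0 = r - c.2%:~R - 2^-1.
Proof.
move=> /andP[nr rn]; exists (const_mx (r - c.2%:~R - 2^-1)).
  by apply/cube_row1; rewrite mxE; apply/andP; split; lra.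
rewrite mxE; split=> //; rewrite /tree_chart /tree_height mxE; congr tpoint.
by ring.
Qed.

Lemma tree_surj x : exists c : lamps H * int, exists2 u, cube u & tree_chart c u = x.
Proof.
have /andP[lo hi] := floor_itv (height x).
have [|u cu [uE _]] := @tree_chart_at (germ x, Num.floor (height x)) (height x).
  by move: hi; rewrite intrD => /ltW hi; rewrite lo.
by exists (germ x, Num.floor (height x)), u; rewrite // uE tpointK.
Qed.

Lemma tree_inj (c : lamps H * int) (u v : 'rV[R]_1) : cube u -> cube v ->
  face_support u = face_support v -> tree_chart c u = tree_chart c v -> u = v.
Proof.
move=> _ _ _ /(congr1 height); rewrite /height /= /tree_height => /addrI uv.
by apply/rowP => i; rewrite ord1.
Qed.

(** Points inside an edge have a height that is not an integer, so only cells with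
    the same integer meet there; their configurations then agree from that
    integer on, so the cells have the same image.  At the ends of an edge the
    faces are points. *)
Lemma tree_gluing (c c' : lamps H * int) (u u' : 'rV[R]_1) :
  cube u -> cube u' -> tree_chart c u = tree_chart c' u' ->
  exists h : 'rV[R]_1 -> 'rV[R]_1,
    [/\ set_bij (face_support u) (face_support u') h,
        forall v w, face_support u v -> face_support u w ->
          edist (h v) (h w) = edist v w
      & forall v, face_support u v -> tree_chart c v = tree_chart c' (h v)].
Proof.
case: c c' => [f n] [f' n'] cu cu' e.
have he : n%:~R + 2^-1 + u 0 0 = n'%:~R + 2^-1 + u' 0 0 by have := congr1 height e.
have corner1 (v : 'rV[R]_1) : `|v 0 0| = 2^-1 -> corner v by move=> ? i; rewrite ord1.
have inside (v : 'rV[R]_1) : cube v -> `|v 0 0| <> 2^-1 -> - 2^-1 < v 0 0 < 2^-1.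
  move=> cv ne; rewrite -ltr_norml lt_neqAle; apply/andP; split; first exact/eqP.
  exact: cv.
have int_eq (a b : int) : (a%:~R : R) < b%:~R + 1 -> (b%:~R : R) < a%:~R + 1 -> a = b.
  rewrite -!intrD1 !ltr_int !ltzD1 => ab ba.
  by apply: le_anti; rewrite ab ba.
have /cube_row1/andP[lo hi] := cu; have /cube_row1/andP[lo' hi'] := cu'.
have [uc|uc] := pselect (`|u 0 0| = 2^-1); last first.
  have /andP[lt gt] := inside _ cu uc.
  have nn' : n = n' by apply: int_eq; lra.
  subst n'; have uu' : u = u' by apply/rowP => i; rewrite ord1; lra.
  subst u'; exists id; split=> [|//|v [/cube_row1/andP[vlo vhi] _]].
    by split=> // v; exists v.
  apply: tpoint_eq => // i; rewrite /tree_height /= => vi.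
  have ni : n <= i.
    have : (n%:~R : R) < (i + 1)%:~R by apply: le_lt_trans vi; lra.
    by rewrite ltr_int ltzD1.
  have ui : tree_height n u < (i + 1)%:~R.
    rewrite /tree_height; have : (n%:~R : R) <= i%:~R by rewrite ler_int.
    by rewrite intrD; lra.
  by have := congr1 (germ ^~ i) e; rewrite /= !germ_tpoint.
have uc' : `|u' 0 0| = 2^-1.
  apply: contrapT => ne; have /andP[lt gt] := inside _ cu' ne.
  have nn' : n = n' by apply: int_eq; lra.
  by apply: ne; rewrite -uc; congr `|_|; subst n'; lra.
rewrite !face_support_corner; try exact: corner1.
exists (fun=> u'); split=> [|v w -> ->|v -> //]; last by rewrite !edist_xx.
by split=> [//|v w|v ->]; [rewrite !inE => -> -> | exists u].
Qed.

Definition tree_complex : cube_complex R :=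
  @CubeComplex R tree_point (lamps H * int)%type (fun=> 1%N) tree_chart
    tree_surj tree_inj tree_gluing.

Local Notation T := tree_complex.

Lemma merge_height_edge f r s :
  merge_height (tpoint f r) (tpoint f s) = Num.max r s.
Proof.
apply: merge_height_eq => q; rewrite merge_height_le ge_max.
split=> [[rq sq _]|/andP[rq sq]]; first exact/andP.
by split=> // i qi; rewrite !germ_tpoint // (le_lt_trans _ qi).
Qed.

Lemma tree_dist_step x y r : @step R T x y r -> tree_dist x y = r.
Proof.
case=> -[f n] [u [v [_ _ <- <- <-]]].
rewrite edist_row1 /tree_dist merge_height_edge /height /= /tree_height.
set a := n%:~R + 2^-1.
have [|] := leP (a + u 0 0) (a + v 0 0) => uv.
  by rewrite distrC ger0_norm ?subr_ge0; lra.
by rewrite ger0_norm ?subr_ge0; lra.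
Qed.

Lemma step_up x r (n : int) : n%:~R <= height x -> height x <= r -> r <= n%:~R + 1 ->
  @step R T x (up r x) (r - height x).
Proof.
move=> nx xr rn.
have [|u cu [uE u0]] := @tree_chart_at (germ x, n) (height x); first by lra.
have [|v cv [vE v0]] := @tree_chart_at (germ x, n) r; first by lra.
exists (germ x, n), u, v; split=> //; first by rewrite [LHS]uE tpointK.
rewrite edist_row1 u0 v0 distrC ger0_norm; first by ring.
by rewrite /=; lra.
Qed.

(** Going up crosses one edge at a time. *)
Lemma chain_up (N : nat) x r (n : int) :
  n%:~R <= height x <= n%:~R + 1 -> height x <= r <= n%:~R + 1 + N%:R ->
  @chain R T x (up r x) (r - height x).
Proof.
elim: N n x => [|N IH] n x /andP[nx xn] /andP[xr rN].
  by apply/step_chain/(step_up nx) => //; rewrite addr0 in rN.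
have [rn|nr] := leP r (n%:~R + 1); first exact/step_chain/(step_up nx).
have := IH (n + 1) (up (n%:~R + 1) x); rewrite height_up intrD up_up; last exact: ltW.
rewrite lexx lerDl ler01 (ltW nr) /= => /(_ isT) ch.
have -> : r - height x = (n%:~R + 1 - height x) + (r - (n%:~R + 1)) by ring.
apply: chain_step (step_up nx xn (lexx _)) _; apply: ch.
by move: rN; rewrite -addn1 natrD; lra.
Qed.

Lemma tree_chain x y : @chain R T x y (tree_dist x y).
Proof.
have upJ z r : height z <= r -> @chain R T z (up r z) (r - height z).
  move=> zr; have /andP[lo /ltW hi] := floor_itv (height z).
  apply: (@chain_up (Num.trunc (r - height z)).+1 _ _ (Num.floor (height z))).
    by move: hi; rewrite intrD lo.
  rewrite zr /=; have := truncnS_gt (r - height z).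
  by move: hi; rewrite intrD; lra.
have [hx hy] := height_merge x y.
have upxy : up (merge_height x y) x = up (merge_height x y) y.
  by apply: tpoint_eq => // i; exact: germ_merge.
have -> : tree_dist x y =
    (merge_height x y - height x) + (merge_height x y - height y).
  by rewrite /tree_dist; ring.
apply: chain_trans (upJ _ _ hx) _; rewrite upxy.
exact/chain_sym/upJ.
Qed.

Lemma complex_dist_tree : @complex_dist R T = tree_dist.
Proof.
apply/funext => x; apply/funext => y; apply: le_anti; apply/andP; split.
  exact: complex_dist_le (tree_chain x y).
have dm := tree_dist_metric.
apply: le_complex_dist => [{}x {}y|z|{}x {}y z|{}x {}y r].
- by exists (tree_dist x y); exact: tree_chain.
- by rewrite (metric_xx dm).
- exact: metric_tri.
- by move=> /tree_dist_step ->.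
Qed.

Lemma tree_cat0 : cat0_complex T.
Proof.
split; first by move=> x y; exists (tree_dist x y); exact: tree_chain.
rewrite complex_dist_tree; apply: cat0_of_stewart.
  exact: tree_dist_metric.
exact: stewart_tree.
Qed.

Definition tree_act (w : W) x : tree_point :=
  tpoint (lamps_mul (lamp_part w) (lamps_shift (shift_part w) (germ x)))
    (height x + (shift_part w)%:~R).

Lemma shift_lt r (m i : int) : r + m%:~R < (i + 1)%:~R :> R ->
  r < (i - m + 1)%:~R.
Proof. by rewrite !(intrD, intrB); lra. Qed.

Lemma tree_act_tpoint w f r : tree_act w (tpoint f r) =
  tpoint (lamps_mul (lamp_part w) (lamps_shift (shift_part w) f))
    (r + (shift_part w)%:~R).
Proof.
apply: tpoint_eq => // i /shift_lt ri.
by rewrite !lamps_mulE !lamps_shiftE germ_tpoint.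
Qed.

Lemma tree_act_action : is_action tree_act.
Proof.
split=> [x|a b x].
  rewrite -[RHS]tpointK; apply: tpoint_eq => [|i _]; first by rewrite /= addr0.
  by rewrite lamps_mulE lamps_shiftE /= fsfun0E mul1g subr0.
rewrite {3}/tree_act tree_act_tpoint; apply: tpoint_eq => [|i _] /=.
  by rewrite intrD; ring.
by rewrite !(lamps_mulE, lamps_shiftE) mulgA opprD addrA.
Qed.

Lemma height_act w x : height (tree_act w x) = height x + (shift_part w)%:~R.
Proof. by []. Qed.

Lemma tree_act_isometry w x y : tree_dist (tree_act w x) (tree_act w y) = tree_dist x y.
Proof.
set m : R := (shift_part w)%:~R.
suff J : merge_height (tree_act w x) (tree_act w y) = merge_height x y + m.
  by rewrite /tree_dist J !height_act -/m; ring.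
apply: merge_height_eq => s; rewrite -lerBrDr !merge_height_le.
rewrite !height_act -/m !lerBrDr.
split=> -[xs ys h]; split=> // i si.
  have si' : s < (i + shift_part w + 1)%:~R.
    by move: si; rewrite !intrD -/m; lra.
  have := h _ si'; rewrite !germ_tpoint; try exact: le_lt_trans si'.
  by rewrite !lamps_mulE !lamps_shiftE addrK => /mulgI.
rewrite !germ_tpoint; try exact: le_lt_trans si.
rewrite !lamps_mulE !lamps_shiftE; congr (_ * _)%g; apply: h.
by move: si; rewrite !(intrD, intrB) -/m; lra.
Qed.

Lemma tree_act_chart w f (n : int) u : tree_act w (tree_chart (f, n) u) =
  tree_chart (lamps_mul (lamp_part w) (lamps_shift (shift_part w) f),
    n + shift_part w) u.
Proof.
rewrite tree_act_tpoint; congr tpoint.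
by rewrite /tree_height /= intrD; ring.
Qed.

Lemma tree_act_cellular w : @cellular_isometry R T (tree_act w).
Proof.
split=> [x y|S [[f n] [u cu ->]]].
  by rewrite complex_dist_tree tree_act_isometry.
exists (lamps_mul (lamp_part w) (lamps_shift (shift_part w) f), n + shift_part w).
exists u => //; rewrite image_comp; apply: eq_imagel => v _ /=.
exact: tree_act_chart.
Qed.

Definition tree_base : tree_point := tpoint [fsfun] 0.

(** The ray from the base point and that from its image cannot merge below the
    height of the image, nor before the germ of the lamps becomes trivial. *)
Lemma tree_act_base w (N : R) : tree_dist tree_base (tree_act w tree_base) <= N ->
  (shift_part w)%:~R <= N /\
  forall i : int, lamp_part w i <> 1%g -> (i + 1)%:~R <= N.
Proof.
set y := tree_act w _; set m : R := (shift_part w)%:~R.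
have hy : height y = m by rewrite height_act add0r.
have hb : height tree_base = 0 by [].
have [b1 y1] := height_merge tree_base y; rewrite hb hy in b1 y1.
rewrite /tree_dist hb hy => JN; split=> [|i fi]; first by lra.
suff : (i + 1)%:~R <= merge_height tree_base y by lra.
rewrite leNgt; apply/negP => Ji; apply: fi.
have := germ_merge Ji; rewrite germ_tpoint ?(le_lt_trans b1) //.
rewrite germ_tpoint ?add0r ?(le_lt_trans y1) // lamps_mulE lamps_shiftE.
rewrite fsfun0E /germ /= lamps_aboveE fsfun0E if_same mulg1.
by move=> <-.
Qed.

Lemma tree_base_vertex : exists c (v : 'rV[R]_1),
  corner v /\ tree_chart c v = tree_base.
Proof.
have [|u _ [uE u0]] := @tree_chart_at ([fsfun], 0) 0; first by rewrite lexx add0r ler01.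
exists ([fsfun], 0), u; split=> // i.
by rewrite ord1 u0 /= subrr sub0r normrN ger0_norm // invr_ge0 ler0n.
Qed.

End Tree.

(** * Properness criteria *)

Section Properness.
Variables (R : realType) (G : groupType) (X : Type).
Variables (d : X -> X -> R) (act : G -> X -> X).
Hypothesis d_sym : forall x y, d x y = d y x.
Hypothesis d_tri : forall y x z, d x z <= d x y + d y z.

(** If [g] moves a point of a bounded set into it, then it moves every point near
    the set by a bounded amount. *)
Lemma proper_of_orbit (o : X) : (forall g x y, d (act g x) (act g y) <= d x y) ->
  (forall N : R, finite_set [set g | d o (act g o) <= N]) ->
  metrically_proper d act.
Proof.
move=> act_le fin B [M BM]; have [[b Bb]|nB] := pselect (B !=set0); last first.
  apply: sub_finite_set (finite_set0 G) => g /= [_ [[y By _] _]].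
  by apply: nB; exists y.
apply: sub_finite_set (fin (d o b + M + M + d o b)) => g /= [_ [[y By <-] Bgy]].
have := act_le g y b; have := BM _ _ By Bb; have := BM _ _ Bb Bgy.
have := act_le g b o; rewrite (d_sym b o).
have := d_tri b o (act g o); have := d_tri (act g y) b (act g o).
by have := d_tri (act g b) (act g y) (act g o); lra.
Qed.

Lemma orbit_of_proper (o : X) : d o o = 0 -> metrically_proper d act ->
  forall N : R, finite_set [set g | d o (act g o) <= N].
Proof.
move=> oo proper N.
have bB : is_bounded d [set x | d o x <= Num.max N 0].
  exists (Num.max N 0 + Num.max N 0) => x y /= ox oy.
  by apply: le_trans (d_tri o x y) _; rewrite (d_sym x); exact: lerD.
apply: sub_finite_set (proper _ bB) => g /= gN; exists (act g o); split.
  by exists o; rewrite //= oo le_max lexx orbT.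
by rewrite /= le_max gN.
Qed.

End Properness.

(** * The wreath product *)

Section Wreath.
Variable H : groupType.
Local Notation W := (wreathZ H).

Lemma lamp_part1 (i : int) : lamp_part (1%g : W) i = 1%g.
Proof. exact: fsfun0E. Qed.

Lemma lamp_partM (a b : W) i :
  lamp_part (a * b)%g i = (lamp_part a i * lamp_part b (i - shift_part a))%g.
Proof. by rewrite lamps_mulE lamps_shiftE. Qed.

Lemma wreath_eq (a b : W) : (forall i, lamp_part a i = lamp_part b i) ->
  shift_part a = shift_part b -> a = b.
Proof.
case: a b => [f n] [g m] /= fg <-; congr Wreath.
exact/fsfunP.
Qed.

Definition flip_lamps (f : lamps H) : lamps H :=
  [fsfun i in [fset - j | j in finsupp f]%fset => f (- i)].

Lemma flip_lampsE f i : flip_lamps f i = f (- i).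
Proof.
rewrite fsfun_fun; case: ifPn => // fi; rewrite fsfun_dflt //.
by apply: contra fi => fi; apply/imfsetP; exists (- i) => //=; rewrite opprK.
Qed.

Definition flip (w : W) : W := Wreath (flip_lamps (lamp_part w)) (- shift_part w).

Lemma flip1 : flip 1%g = 1%g.
Proof. by apply: wreath_eq => [i|] /=; rewrite ?flip_lampsE ?fsfun0E ?oppr0. Qed.

Lemma flipM a b : flip (a * b)%g = (flip a * flip b)%g.
Proof.
apply: wreath_eq => [i|]; last exact: opprD.
by rewrite lamp_partM /= !flip_lampsE lamps_mulE lamps_shiftE opprK opprD.
Qed.

(** One-sided constructions are used twice, looking towards [+oo] and, through
    the reflection, towards [-oo]. *)
Definition side (s : bool) (w : W) : W := if s then w else flip w.

Lemma side1 s : side s 1%g = 1%g.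
Proof. by case: s => //; exact: flip1. Qed.

Lemma sideM s a b : side s (a * b)%g = (side s a * side s b)%g.
Proof. by case: s => //; exact: flipM. Qed.

Lemma finite_absz_le (n : nat) : finite_set [set i : int | (`|i| <= n)%N].
Proof.
apply: (@sub_finite_set _ _ ((Posz @` `I_n.+1) `|` ((fun k => - k%:Z) @` `I_n.+1))).
  move=> i /= iN; have [i0|i0] := leP 0 i; [left|right]; exists `|i|%N => //.
    by rewrite gez0_abs.
  by rewrite ltz0_abs // opprK.
by rewrite finite_setU; split; apply: finite_image; exact: finite_II.
Qed.

Lemma finite_int_ball (R : realType) (N : R) :
  finite_set [set i : int | `|i%:~R| <= N].
Proof.
apply: sub_finite_set (finite_absz_le (Num.bound N)) => i /= iN.
rewrite -(ler_nat R) natr_absz intr_norm.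
exact: ltW (le_lt_trans iN (archi_boundP (le_trans (normr_ge0 _) iN))).
Qed.

(** Properness reduces to this: the two trees bound the shift and the support,
    and the copies of the space of [H] restrict the lamps to a finite set. *)
Lemma finite_wreath_ball (R : realType) (N : R) (A : set H) : finite_set A ->
  finite_set [set w : W | [/\ `|(shift_part w)%:~R| <= N,
    forall i : int, lamp_part w i <> 1%g -> `|i%:~R| <= N
    & forall i, A (lamp_part w i)]].
Proof.
move=> finA; pose D := fset_set [set i : int | `|i%:~R| <= N].
have DE (i : int) : (i \in D) = (`|i%:~R : R| <= N).
  by rewrite in_fset_set; [apply/idP/idP; rewrite inE | exact: finite_int_ball].
pose A' := fset_set A.
have A'E h : A h -> h \in A' by move=> Ah; rewrite in_fset_set // inE.
pose mk (p : {ffun D -> A'} * D) : W :=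
  Wreath [fsfun i : D => val (p.1 i)] (val p.2).
apply: (@sub_finite_set _ _ (mk @` [set: _])); last first.
  by apply: finite_image; exact: finite_finset.
move=> w /= [sw lw Aw].
have sD : shift_part w \in D by rewrite DE.
exists ([ffun i : D => [` A'E _ (Aw (val i))]%fset], [` sD]%fset) => //.
apply: wreath_eq => // i; rewrite /mk /= fsfun_ffun.
case: insubP => [j _ <-|iD] /=; first by rewrite ffunE.
apply: contrapT => ne; move/negP: iD; apply; rewrite DE; apply: lw.
exact: nesym.
Qed.

(** Indices of the factors: the two sides of the line, and its points. *)
Definition relabelZ (w : W) (i : bool + int) : bool + int :=
  if i is inr k then inr (k - shift_part w) else i.

Lemma relabelZ_bij w : bijective (relabelZ w).
Proof.
exists (fun i => if i is inr k then inr (k + shift_part w) else i).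
  by case=> [s|k] //=; rewrite subrK.
by case=> [s|k] //=; rewrite addrK.
Qed.

Lemma finite_moved (w : W) (P : set (bool + int)) :
  (forall k, lamp_part w k = 1%g -> ~ P (inr k)) -> finite_set P.
Proof.
move=> h; apply: (@sub_finite_set _ _ ((inl @` [set: bool]) `|`
    (inr @` [set` finsupp (lamp_part w)]))); last first.
  by rewrite finite_setU; split; apply: finite_image;
    [exact: finite_finset | exact: finite_fset].
case=> [s|k] Pi; [left; by exists s|right; exists k => //=].
by rewrite mem_finsupp; apply/eqP => /h.
Qed.

End Wreath.

(** * The cube complex of the wreath product *)

Section WreathComplex.
Variables (R : realType) (H : groupType).
Local Notation W := (wreathZ H).

Variables (K : cube_complex R) (act : H -> cpoint K -> cpoint K).
Hypothesis catK : cat0_complex K.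
Hypothesis actA : is_action act.
Hypothesis act_cell : forall h, cellular_isometry (act h).
Variables (cK : cell K) (vK : 'rV[R]_(cdim cK)).
Hypothesis vKP : corner vK.

Variables (cT : lamps H * int) (vT : 'rV[R]_1).
Hypothesis vTP : corner vT.
Hypothesis vTE : tree_chart cT vT = tree_base R H.

Definition pointed_tree : cube_complex R :=
  @add_vertex R (tree_complex R H) cT vT vTP.

Definition pointed_complex : cube_complex R := add_vertex vKP.

Definition factor (i : bool + int) : cube_complex R :=
  if i is inl _ then pointed_tree else pointed_complex.

Definition factor_vertex (i : bool + int) : cell (factor i) :=
  match i with inl _ => None | inr _ => None end.

Lemma factor_vertex_dim i : cdim (factor_vertex i) = 0%N.
Proof. by case: i. Qed.

Lemma factor_cat0 i : cat0_complex (factor i).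
Proof. by case: i => [s|k]; apply: cat0_add_vertex => //; exact: tree_cat0. Qed.

Definition factor_act (w : W) (j : bool + int) :
    cpoint (factor (relabelZ w j)) -> cpoint (factor j) :=
  match j with
  | inl s => tree_act (side s w)
  | inr k => act (lamp_part w k)
  end.

Arguments factor_act : clear implicits.

Local Notation base := (base_vertex factor_vertex).

Lemma factor_act_base w :
  finite_set [set j | factor_act w j (base (relabelZ w j)) <> base j].
Proof.
apply: (@finite_moved _ w) => k wk /= ne; apply: ne.
by rewrite wk actA.1.
Qed.

Definition wreath_complex : cube_complex R := product_complex factor_vertex_dim.

Definition wreath_act (w : W) : cpoint wreath_complex -> cpoint wreath_complex :=
  relabel (bij_inj (relabelZ_bij w)) (factor_act_base w).

Lemma wreath_act_action : is_action wreath_act.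
Proof.
split=> [x|a b x]; apply: rprod_eq => -[s|k] /=.
- by rewrite side1 (tree_act_action R H).1.
- by rewrite lamp_part1 actA.1 subr0.
- by rewrite sideM (tree_act_action R H).2.
- by rewrite lamp_partM actA.2 opprD addrA.
Qed.

Lemma wreath_act_cellular w : cellular_isometry (wreath_act w).
Proof.
apply: cellular_relabel.
- exact: factor_cat0.
- case=> [s|k] u v.
    have [iso _] := @cellular_isometry_add_vertex R (tree_complex R H) cT vT vTP _
      (tree_act_cellular R (side s w)).
    exact: iso.
  have [iso _] := cellular_isometry_add_vertex vKP (act_cell (lamp_part w k)).
  exact: iso.
- case=> [s|k] S.
    have [_ cl] := @cellular_isometry_add_vertex R (tree_complex R H) cT vT vTP _
      (tree_act_cellular R (side s w)).
    exact: cl.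
  have [_ cl] := cellular_isometry_add_vertex vKP (act_cell (lamp_part w k)).
  exact: cl.
Qed.

Definition wreath_base : cpoint wreath_complex := rbase base.

(** The displacement in the product bounds that in each factor: the trees bound
    the shift and the support, the copies of [K] bound the lamps. *)
Lemma wreath_act_base w (N : R) :
  complex_dist wreath_base (wreath_act w wreath_base) <= N ->
  [/\ `|(shift_part w)%:~R| <= N,
      forall i : int, lamp_part w i <> 1%g -> `|i%:~R| <= N
    & forall i : int, complex_dist (chart vK) (act (lamp_part w i) (chart vK)) <= N].
Proof.
rewrite complex_dist_product; last exact: factor_cat0.
move=> dN; have le i : complex_dist (base i) (factor_act w i (base (relabelZ w i))) <= N.
  apply: le_trans dN.
  exact: (le_l2dist (factor_metric factor_cat0) wreath_base (wreath_act w wreath_base) i).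
have tree s : tree_dist (tree_base R H) (tree_act (side s w) (tree_base R H)) <= N.
  have := le (inl s); rewrite /= /base_vertex /= vTE.
  by rewrite complex_dist_add_vertex complex_dist_tree.
have [sN lN] := tree_act_base (tree true); have [sN' lN'] := tree_act_base (tree false).
split.
- by rewrite ler_norml; move: sN sN'; rewrite /= mulrNz; lra.
- move=> i ne; have := lN i ne; have := lN' (- i).
  rewrite /= flip_lampsE opprK => /(_ ne).
  by rewrite ler_norml !intrD mulrNz; lra.
- by move=> i; have := le (inr i); rewrite /= /base_vertex /= complex_dist_add_vertex.
Qed.

Lemma wreath_act_proper : metrically_proper (@complex_dist R K) act ->
  metrically_proper (@complex_dist R wreath_complex) wreath_act.
Proof.
move=> proper.
have Km : is_metric (@complex_dist R K) by case: catK => _ [].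
have Wm : is_metric (@complex_dist R wreath_complex).
  by have [_ []] := product_cat0 factor_vertex_dim factor_cat0.
have [_ Ks Kt] := Km; have [_ Ws Wt] := Wm.
apply: (proper_of_orbit Ws (fun y x z => Wt x y z) (o := wreath_base)).
  by move=> w x y; have [-> _] := wreath_act_cellular w.
move=> N; have := orbit_of_proper Ks (fun y x z => Kt x y z)
  (metric_xx Km (chart vK)) proper N.
move=> /(finite_wreath_ball N); apply: sub_finite_set => w /= /wreath_act_base[? ? ?].
by split.
Qed.

End WreathComplex.

Lemma wreath_acts_on_cat0 (R : realType) (H : groupType) :
  acts_properly_on_cat0_cube_complex R H ->
  acts_properly_on_cat0_cube_complex R (wreathZ H).
Proof.
case=> K [act [[x _] catK actA act_cell proper]].
have [cK _] := chart_surj x.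
pose vK : 'rV[R]_(cdim cK) := const_mx 2^-1.
have vKP : corner vK by move=> i; rewrite mxE ger0_norm // invr_ge0 ler0n.
have [cT [vT [vTP vTE]]] := tree_base_vertex R H.
exists (wreath_complex vKP cT vTP), (@wreath_act R H K act actA cK vK vKP cT vT vTP); split.
- by exists (wreath_base vKP cT vTP).
- exact: product_cat0 (factor_cat0 catK vKP cT vTP).
- exact: wreath_act_action.
- exact: wreath_act_cellular.
- exact: wreath_act_proper.
Qed.

(** * Spaces with walls *)

Section Walls.

Lemma is_wall_preimage (X Y : Type) (f : Y -> X) (w : set (set X)) :
  (forall x, exists y, f y = x) -> is_wall w ->
  is_wall [set f @^-1` A | A in w].
Proof.
move=> fS [[cov triv ne] card2]; split; last first.
  apply: card_eq_trans card2; apply: inj_card_eq => A B _ _ AB.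
  apply/seteqP; split=> x; have [y <-] := fS x.
    by rewrite -[A _]/((f @^-1` A) y) AB.
  by rewrite -[B _]/((f @^-1` B) y) -AB.
split.
- apply/seteqP; split=> // y _; have : cover w id (f y) by rewrite cov.
  by case=> A wA Afy; exists (f @^-1` A) => //; exists A.
- move=> _ _ [A wA <-] [B wB <-] [y [/= Ay By]].
  by rewrite (triv A B wA wB) //; exists (f y).
- by move=> _ [A wA <-]; have [x Ax] := ne _ wA; have [y yx] := fS x;
  exists y; rewrite /= yx.
Qed.

Lemma is_wall_halfspace (X : Type) (A : set X) : A !=set0 -> ~` A !=set0 ->
  is_wall [set A; ~` A].
Proof.
move=> [a Aa] [b nAb].
have ne : ~` A <> A by move=> e; apply: (nAb); rewrite -e.
split; last first.
  apply/card_set_bijP; exists (fun B => if `[< B = A >] then 0%N else 1%N); split.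
  - by move=> B _ /=; case: asboolP.
  - move=> B C; rewrite !inE /= => -[->|->] [->|->] //; case: asboolP => // ?;
      by case: asboolP.
  - move=> [|[|//]] _; [exists A; first by left | exists (~` A); first by right].
      by case: asboolP.
    by case: asboolP.
split.
- apply/seteqP; split=> // x _; have [Ax|nAx] := pselect (A x).
    by exists A => //; left.
  by exists (~` A) => //; right.
- by move=> B C [->|->] [->|->] // [x []].
- by move=> B [->|->]; [exists a | exists b].
Qed.

Lemma separates_halfspace (X : Type) (A : set X) x y :
  separates [set A; ~` A] x y <-> (A x /\ ~ A y) \/ (~ A x /\ A y).
Proof.
split=> [h|[[Ax nAy]|[nAx Ay]] [B [->|->] []] //].
have [Ax|nAx] := pselect (A x); have [Ay|nAy] := pselect (A y).
- by case: h; exists A => //; left.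
- by left.
- by right.
- by case: h; exists (~` A) => //; right.
Qed.

Lemma separates_sym (X : Type) (w : set (set X)) x y :
  separates w x y -> separates w y x.
Proof. by move=> h [A wA [? ?]]; apply: h; exists A. Qed.

Lemma separates_irrefl (X : Type) (w : set (set X)) x : is_wall w -> ~ separates w x x.
Proof.
move=> [[cov _ _] _]; have : cover w id x by rewrite cov.
by case=> A wA Ax; apply; exists A.
Qed.

Lemma separates_tri (X : Type) (w : set (set X)) y x z : is_wall w ->
  separates w x z -> separates w x y \/ separates w y z.
Proof.
move=> [[_ triv _] _] xz; apply: contrapT => /not_orP[].
move=> /contrapT[A wA [Ax Ay]] /contrapT[B wB [By Bz]].
have AB : A = B by apply: (triv A B wA wB); exists y.
by apply: xz; exists A => //; rewrite {2}AB.
Qed.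

Definition separators (X : wall_space) (x y : wpoint X) : set (set (set (wpoint X))) :=
  [set w | walls w /\ separates w x y].

Lemma finite_separators (X : wall_space) (x y : wpoint X) :
  finite_set (separators x y).
Proof. exact: finite_separating. Qed.

Lemma card_fset_set_inj (S T : choiceType) (A : set S) (B : set T) (F : S -> T) :
  finite_set A -> finite_set B ->
  (forall w, A w -> B (F w)) -> {in A &, injective F} ->
  (#|` fset_set A| <= #|` fset_set B|)%N.
Proof.
move=> fA fB AB inj.
have <- : #|` [fset F w | w in fset_set A]%fset| = #|` fset_set A|.
  by apply: card_in_imfset => a c; rewrite /= !in_fset_set //; exact: inj.
apply: fsubset_leq_card; apply/fsubsetP => _ /imfsetP[w /= wA ->].
by move: wA; rewrite !in_fset_set // !inE; exact: AB.
Qed.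

Lemma wall_dist_inj (X Y : wall_space) (x y : wpoint X) (x' y' : wpoint Y) F :
  (forall w, separators x y w -> separators x' y' (F w)) ->
  {in separators x y &, injective F} -> (wall_dist x y <= wall_dist x' y')%N.
Proof. exact: card_fset_set_inj (finite_separators _ _) (finite_separators _ _). Qed.

Lemma wall_dist_sym (X : wall_space) (x y : wpoint X) : wall_dist x y = wall_dist y x.
Proof.
by apply/eqP; rewrite eqn_leq; apply/andP; split; apply: (@wall_dist_inj _ _ _ _ _ _ id) => //;
  move=> w [ww sw]; split=> //; exact: separates_sym.
Qed.

Lemma wall_dist_xx (X : wall_space) (x : wpoint X) : wall_dist x x = 0%N.
Proof.
rewrite /wall_dist (_ : [set w | _] = set0) ?fset_set0 ?cardfs0 //.
apply/seteqP; split=> // w [/wallsP ww].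
exact: separates_irrefl.
Qed.

Lemma wall_dist_tri (X : wall_space) (y x z : wpoint X) :
  (wall_dist x z <= wall_dist x y + wall_dist y z)%N.
Proof.
have fin := finite_separators; apply: leq_trans (_ : _ <=
  #|` fset_set (separators x y) `|` fset_set (separators y z)|%fset)%N _.
  apply: fsubset_leq_card; apply/fsubsetP => w.
  rewrite in_fsetU !in_fset_set ?inE; try exact: fin.
  move=> [ww sw]; have [sxy|syz] := separates_tri y (wallsP ww) sw.
    by apply/orP; left; rewrite inE.
  by apply/orP; right; rewrite inE.
by rewrite cardfsU leq_subr.
Qed.

(** The inverse of [g] maps the walls between the images back to distinct walls
    between the two points. *)
Lemma preserves_walls_le (X : wall_space) (G : groupType) (act : G -> wpoint X -> wpoint X)
    g (x y : wpoint X) : is_action act -> (forall h, preserves_walls (act h)) ->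
  (wall_dist (act g x) (act g y) <= wall_dist x y)%N.
Proof.
move=> [act1 actM] pw.
have actK h z : act h^-1%g (act h z) = z by rewrite -actM mulVg act1.
have actVK h z : act h (act h^-1%g z) = z by rewrite -actM mulgV act1.
apply: (@wall_dist_inj _ _ _ _ _ _ (fun w => [set act g^-1%g @` A | A in w])).
  move=> w [ww sw]; split; first exact: pw.
  move=> [_ [A wA <-] [[a Aa ax] [b Ab bY]]]; apply: sw; exists A => //.
  by rewrite -ax -bY !actVK.
apply: (can_in_inj (g := fun w => [set act g @` A | A in w])) => w _.
have idA A : act g @` (act g^-1%g @` A) = A.
  rewrite image_comp (_ : _ \o _ = id) ?image_id //.
  by apply/funext => z /=; rewrite actVK.
by apply/seteqP; split=> [_ [_ [A wA <-] <-]|A wA]; rewrite ?idA //;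
  exists (act g^-1%g @` A); rewrite ?idA //; exists A.
Qed.

End Walls.

(** Walls of a restricted product are the preimages of the walls of the factors.
    Two points are separated by finitely many of them because they differ at
    finitely many indices. *)
Section ProductWalls.
Variables (I : choiceType) (X : I -> wall_space) (b : forall i, wpoint (X i)).
Local Notation P := (rprod b).

Definition pull i (w : set (set (wpoint (X i)))) : set (set P) :=
  [set (fun x : P => sval x i) @^-1` A | A in w].

Lemma coordinate_surj i (a : wpoint (X i)) : exists x : P, sval x i = a.
Proof. by exists (upd (rbase b) a); rewrite upd_in. Qed.

Definition pwalls : set (set (set P)) :=
  [set w' | exists i (w : set (set (wpoint (X i)))), walls w /\ w' = pull w].

Lemma pwallsP w : pwalls w -> is_wall w.
Proof.
move=> [i [v [/wallsP wv ->]]].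
by apply: is_wall_preimage wv; exact: coordinate_surj.
Qed.

Lemma separates_pull i (w : set (set (wpoint (X i)))) (x y : P) :
  separates (pull w) x y <-> separates w (sval x i) (sval y i).
Proof.
split=> h [A wA [Ax Ay]]; apply: h.
  by exists ((fun x : P => sval x i) @^-1` A) => //; exists A.
by case: wA Ax Ay => B wB <- /= Bx By; exists B.
Qed.

Lemma pwalls_finite_separating (x y : P) :
  finite_set [set w | pwalls w /\ separates w x y].
Proof.
apply: (@sub_finite_set _ _ (\bigcup_(i in [set i | sval x i <> sval y i])
    (@pull i @` separators (sval x i) (sval y i)))); last first.
  apply: bigcup_finite; first exact: finite_diff.
  by move=> i _; apply: finite_image; exact: finite_separators.
move=> w [[i [v [wv ->]]] /separates_pull sv]; exists i; last by exists v.
by move=> /= e; move: sv; rewrite e; exact/separates_irrefl/wallsP.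
Qed.

Definition product_walls : wall_space := WallSpace pwallsP pwalls_finite_separating.

Lemma wall_dist_coordinate i (x y : wpoint product_walls) :
  (wall_dist (sval x i) (sval y i) <= wall_dist x y)%N.
Proof.
apply: (@wall_dist_inj _ product_walls _ _ _ _ (@pull i)).
  by move=> w [ww sw]; split; [exists i, w | apply/separates_pull].
have pullP (w : set (set (wpoint (X i)))) A :
    w A <-> pull w ((fun x : P => sval x i) @^-1` A).
  split=> [wA|[B wB]]; first by exists A.
  suff inj C D : (fun x : P => sval x i) @^-1` C `<=` (fun x : P => sval x i) @^-1` D ->
      C `<=` D by move=> /seteqP[/inj BA /inj AB]; rewrite -(_ : B = A) //; apply/seteqP.
  by move=> CD a; have [z <-] := coordinate_surj a; exact: CD.
by move=> v w _ _ vw; apply/seteqP; split=> A /pullP h; apply/pullP; rewrite ?vw // -vw.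
Qed.

Lemma relabel_preserves_walls tau
    (phi : forall j, wpoint (X (tau j)) -> wpoint (X j)) (bij : bijective tau)
    (fin : finite_set [set j | phi j (b (tau j)) <> b j]) :
  (forall j, injective (phi j)) ->
  (forall j w, walls w -> walls [set phi j @` A | A in w]) ->
  (forall y, exists x, relabel (bij_inj bij) fin x = y) ->
  @preserves_walls product_walls (relabel (bij_inj bij) fin).
Proof.
move=> inj pw surj _ [i [w [ww ->]]]; have [rho _ rhoK] := bij.
move: w ww; rewrite -(rhoK i); set j := rho i => w ww.
exists j, [set phi j @` A | A in w]; split; first exact: pw.
have im A : relabel (bij_inj bij) fin @` ((fun x : P => sval x (tau j)) @^-1` A) =
    (fun x : P => sval x j) @^-1` (phi j @` A).
  apply/seteqP; split=> [_ [x /= Ax <-]|y /= [a Aa ay]]; first by exists (sval x (tau j)).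
  have [x xy] := surj y; exists x => //=.
  suff <- : a = sval x (tau j) by [].
  by apply: inj; rewrite ay -xy.
apply/seteqP; split=> [_ [_ [A wA <-] <-]|_ [_ [A wA <-] <-]].
  by rewrite im; exists (phi j @` A) => //; exists A.
by rewrite -im; exists ((fun x : P => sval x (tau j)) @^-1` A) => //; exists A.
Qed.

End ProductWalls.

(** * Walls of the tree of ends *)

Section TreeWalls.
Variable H : groupType.
Local Notation W := (wreathZ H).

(** The halfspace of the tree of ends strictly below the vertex that the germ of
    [f] names at height [k], pulled back to the group along the orbit of the
    base point. *)
Definition below (k : int) (f : lamps H) : set W :=
  [set w | shift_part w < k /\ forall i, k <= i -> lamp_part w i = f i].

Definition below_wall k f : set (set W) := [set below k f; ~` below k f].

Definition twalls : set (set (set W)) := [set w | exists k f, w = below_wall k f].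

Lemma twallsP w : twalls w -> is_wall w.
Proof.
move=> [k [f ->]]; apply: is_wall_halfspace.
  by exists (Wreath f (k - 1)); split=> //=; lia.
by exists (Wreath f k) => -[/=]; rewrite ltxx.
Qed.

Lemma below_lamp k f x : below k f x -> below k f = below k (lamp_part x).
Proof.
move=> [_ xf]; apply/seteqP; split=> y [yk yf]; split=> // i ki;
  by rewrite yf // xf.
Qed.

(** A halfspace that contains [x] is the one named by the lamps of [x] at its
    height; if it does not contain [y], its height lies between the shift of [x]
    and a bound on the shift and the lamps of both. *)
Lemma twalls_finite_separating (x y : W) :
  finite_set [set w | twalls w /\ separates w x y].
Proof.
pose s := [:: shift_part x; shift_part y] ++
  (finsupp (lamp_part x) ++ finsupp (lamp_part y)).
pose n := \max_(j <- s) `|j|%N.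
have sn j : j \in s -> (`|j| <= n)%N by move=> js; exact: leq_bigmax_seq.
have bound z z' k : z \in [:: x; y] -> z' \in [:: x; y] ->
    below k (lamp_part z) z -> ~ below k (lamp_part z) z' -> (`|k| <= n)%N.
  move=> zxy zxy' [zk _] nz'.
  have zn u : u \in [:: x; y] -> (`|shift_part u| <= n)%N.
    by rewrite !inE => /orP[]/eqP->; apply: sn; rewrite !inE eqxx ?orbT.
  have ln u i : u \in [:: x; y] -> lamp_part u i <> 1%g -> (`|i| <= n)%N.
    move=> uxy ui; apply: sn; rewrite !inE mem_cat !mem_finsupp.
    by move: uxy; rewrite !inE => /orP[]/eqP<-; move/eqP: ui => ->; rewrite ?orbT.
  have := zn _ zxy; have [kz'|z'k] := leP k (shift_part z').
    by have := zn _ zxy'; lia.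
  have [i [ki ne]] : exists i, k <= i /\ lamp_part z' i <> lamp_part z i.
    apply: contrapT => h; apply: nz'; split=> // i ki.
    by apply: contrapT => ne; apply: h; exists i.
  have : (`|i| <= n)%N; last by lia.
  have [z1|] := pselect (lamp_part z i = 1%g); last exact: ln.
  by apply: ln zxy' _ => z'1; apply: ne; rewrite z1 z'1.
apply: (@sub_finite_set _ _
    (((fun k => below_wall k (lamp_part x)) @` [set k | (`|k| <= n)%N]) `|`
     ((fun k => below_wall k (lamp_part y)) @` [set k | (`|k| <= n)%N]))); last first.
  by rewrite finite_setU; split; apply: finite_image; exact: finite_absz_le.
have [xs ys] : x \in [:: x; y] /\ y \in [:: x; y] by rewrite !inE !eqxx orbT.
move=> _ [[k [f ->]] /separates_halfspace[[Ax nAy]|[nAx Ay]]]; [left|right]; exists k.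
- by have e := below_lamp Ax; rewrite e in Ax nAy; exact: bound xs ys Ax nAy.
- by rewrite /below_wall (below_lamp Ax).
- by have e := below_lamp Ay; rewrite e in Ay nAx; exact: bound ys xs Ay nAx.
- by rewrite /below_wall (below_lamp Ay).
Qed.

Definition tree_walls : wall_space := WallSpace twallsP twalls_finite_separating.

Lemma mul_preserves_twalls (g : W) : @preserves_walls tree_walls (fun w => (g * w)%g).
Proof.
have imE (A : set W) : [set (g * w)%g | w in A] = [set w | A (g^-1 * w)%g].
  apply/seteqP; split=> [_ [w Aw <-]|w /= Aw]; first by rewrite /= mulKg.
  by exists (g^-1 * w)%g => //; rewrite mulVKg.
move=> _ [k [f ->]].
exists (k + shift_part g), (lamps_mul (lamp_part g) (lamps_shift (shift_part g) f)).
have belowE : [set w | below k f (g^-1 * w)%g] =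
    below (k + shift_part g) (lamps_mul (lamp_part g) (lamps_shift (shift_part g) f)).
  rewrite -imE; apply/seteqP; split=> [_ [w [wk wf] <-]|w [wk wf]].
    split=> [|i ki]; first by move: wk => /=; lia.
    by rewrite lamp_partM lamps_mulE lamps_shiftE wf //; lia.
  exists (g^-1 * w)%g; last by rewrite mulVKg.
  split=> [|i ki]; first by move: wk => /=; lia.
  rewrite lamp_partM /= lamps_shiftE lamps_invE !opprK wf; last by lia.
  by rewrite lamps_mulE lamps_shiftE addrK mulKg.
rewrite /below_wall -belowE.
apply/seteqP; split=> [_ [A [->|->] <-]|A [->|->]]; rewrite ?imE.
- by left.
- by right.
- by exists (below k f); [left | rewrite imE].
- by exists (~` below k f); [right | rewrite imE].
Qed.

(** The halfspaces of the trivial configuration at the heights from [1] to [k] all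
    contain [1], and none of them contains [g]. *)
Lemma wall_dist_one (g : W) (k : nat) :
  k%:Z <= shift_part g \/ (exists2 i, k%:Z <= i & lamp_part g i <> 1%g) ->
  (k <= @wall_dist tree_walls 1%g g)%N.
Proof.
move=> hk; pose F (j : nat) := below_wall j.+1%:Z [fsfun].
have below1 (j : nat) : below j.+1%:Z [fsfun] 1%g.
  by split=> //= i _; rewrite lamp_part1 fsfun0E.
have := @card_fset_set_inj _ _ `I_k (@separators tree_walls 1%g g) F (finite_II k)
  (finite_separators (X := tree_walls) _ _).
rewrite fset_set_II card_imfset; last exact: val_inj.
rewrite -cardE card_ord; apply.
  move=> j /= jk; split; first by exists j.+1%:Z, [fsfun].
  apply/separates_halfspace; left; split=> // -[gj gf].
  case: hk => [|[i ki gi]]; first by lia.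
  by apply: gi; rewrite gf ?fsfun0E //; lia.
move=> i j _ _ Fij.
have bij : below i.+1%:Z [fsfun] = below j.+1%:Z [fsfun].
  have : F i (below i.+1%:Z [fsfun]) by left.
  rewrite Fij => -[//|e]; have := below1 i; rewrite e.
  by case; exact: below1.
have le (a c : nat) : below a.+1%:Z ([fsfun] : lamps H) = below c.+1%:Z [fsfun] ->
    (c <= a)%N.
  move=> ac; have : below c.+1%:Z [fsfun] (Wreath ([fsfun] : lamps H) c%:Z).
    by split=> //=; lia.
  by rewrite -ac => -[/=]; lia.
by apply/eqP; rewrite eqn_leq !le.
Qed.

Lemma wall_dist_one_bound (R : realType) (g : W) (N : R) :
  (@wall_dist tree_walls 1%g g)%:R <= N ->
  (shift_part g)%:~R <= N /\
  forall i : int, lamp_part g i <> 1%g -> i%:~R <= N.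
Proof.
move=> gN; have key (i : int) : i <= shift_part g \/ lamp_part g i <> 1%g -> i%:~R <= N.
  have N0 : 0 <= N by apply: le_trans gN; rewrite ler0n.
  have [i0 h|i0 _] := leP 0 i; last by apply: le_trans N0; rewrite lerz0 ltW.
  apply: le_trans gN; rewrite -(gez0_abs i0) ler_nat; apply: wall_dist_one.
  rewrite gez0_abs //; case: h; [by left | by right; exists i].
by split=> [|i gi]; apply: key; [left | right].
Qed.

End TreeWalls.

(** * The space with walls of the wreath product *)

Section WreathWalls.
Variables (R : realType) (H : groupType).
Local Notation W := (wreathZ H).
Variables (X : wall_space) (act : H -> wpoint X -> wpoint X) (x0 : wpoint X).
Hypothesis actA : is_action act.
Hypothesis act_walls : forall h, preserves_walls (act h).

Definition wfactor (i : bool + int) : wall_space :=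
  if i is inl _ then tree_walls H else X.

Definition wfactor_base (i : bool + int) : wpoint (wfactor i) :=
  match i with inl _ => (1%g : W) | inr _ => x0 end.

Definition wfactor_act (w : W) (j : bool + int) :
    wpoint (wfactor (relabelZ w j)) -> wpoint (wfactor j) :=
  match j with
  | inl s => fun v : W => (side s w * v)%g
  | inr k => act (lamp_part w k)
  end.
Arguments wfactor_act : clear implicits.

Lemma wfactor_act_base w :
  finite_set [set j | wfactor_act w j (wfactor_base (relabelZ w j)) <> wfactor_base j].
Proof.
apply: (@finite_moved _ w) => k wk /= ne; apply: ne.
by rewrite wk actA.1.
Qed.

Definition wreath_walls : wall_space := product_walls wfactor_base.

Definition wreath_walls_act (w : W) : wpoint wreath_walls -> wpoint wreath_walls :=
  relabel (bij_inj (relabelZ_bij w)) (wfactor_act_base w).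

Lemma wreath_walls_action : is_action wreath_walls_act.
Proof.
split=> [x|a b x]; apply: rprod_eq => -[s|k] /=.
- by rewrite side1 mul1g.
- by rewrite lamp_part1 actA.1 subr0.
- by rewrite sideM mulgA.
- by rewrite lamp_partM actA.2 opprD addrA.
Qed.

Lemma wreath_walls_preserved w : preserves_walls (wreath_walls_act w).
Proof.
apply: relabel_preserves_walls.
- case=> [s|k] u v /=; first exact: mulgI.
  move=> /(congr1 (act (lamp_part w k)^-1%g)).
  by rewrite -!actA.2 mulVg !actA.1.
- by case=> [s|k] v; [exact: mul_preserves_twalls | exact: act_walls].
- move=> y; exists (wreath_walls_act w^-1%g y).
  by rewrite -[LHS](wreath_walls_action.2 w w^-1%g y) mulgV wreath_walls_action.1.
Qed.

Definition wreath_walls_base : wpoint wreath_walls := rbase wfactor_base.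

Lemma wreath_walls_act_base w (N : R) :
  (wall_dist wreath_walls_base (wreath_walls_act w wreath_walls_base))%:R <= N ->
  [/\ `|(shift_part w)%:~R| <= N,
      forall i : int, lamp_part w i <> 1%g -> `|i%:~R| <= N
    & forall i : int, (wall_dist x0 (act (lamp_part w i) x0))%:R <= N].
Proof.
move=> dN; have le i : (wall_dist (wfactor_base i)
    (wfactor_act w i (wfactor_base (relabelZ w i))))%:R <= N.
  apply: le_trans dN; rewrite ler_nat.
  exact: (wall_dist_coordinate i (wreath_walls_base) (wreath_walls_act w wreath_walls_base)).
have tree s : (@wall_dist (tree_walls H) 1%g (side s w))%:R <= N.
  by have := le (inl s); rewrite /= mulg1.
have [sN lN] := wall_dist_one_bound (tree true).
have [sN' lN'] := wall_dist_one_bound (tree false).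
split.
- by rewrite ler_norml; move: sN sN'; rewrite /= mulrNz; lra.
- move=> i ne; have := lN i ne; have := lN' (- i).
  rewrite /= flip_lampsE opprK => /(_ ne).
  by rewrite ler_norml mulrNz; lra.
- by move=> i; exact: (le (inr i)).
Qed.

Lemma wreath_walls_proper :
  metrically_proper (fun x y : wpoint X => (wall_dist x y)%:R : R) act ->
  metrically_proper (fun x y : wpoint wreath_walls => (wall_dist x y)%:R : R)
    wreath_walls_act.
Proof.
move=> proper.
have sym (Y : wall_space) (x y : wpoint Y) : (wall_dist x y)%:R = (wall_dist y x)%:R :> R.
  by rewrite wall_dist_sym.
have tri (Y : wall_space) (y x z : wpoint Y) :
    (wall_dist x z)%:R <= (wall_dist x y)%:R + (wall_dist y z)%:R :> R.
  by rewrite -natrD ler_nat; exact: wall_dist_tri.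
apply: (proper_of_orbit (@sym _) (@tri _) (o := wreath_walls_base)).
  move=> w x y; rewrite ler_nat.
  exact: preserves_walls_le wreath_walls_action wreath_walls_preserved.
have x00 : (wall_dist x0 x0)%:R = 0 :> R by rewrite wall_dist_xx.
move=> N; have := orbit_of_proper (@sym _) (@tri _) x00 proper N.
move=> /(finite_wreath_ball N); apply: sub_finite_set => w /=.
by move=> /wreath_walls_act_base[? ? ?]; split.
Qed.

End WreathWalls.

Lemma wreath_acts_on_walls (R : realType) (H : groupType) :
  acts_properly_on_walls R H -> acts_properly_on_walls R (wreathZ H).
Proof.
case=> X [act [[x0 _] actA act_walls proper]].
exists (wreath_walls H x0), (@wreath_walls_act H X act x0 actA); split.
- by exists (wreath_walls_base H x0).
- exact: wreath_walls_action.
- exact: wreath_walls_preserved.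
- exact: wreath_walls_proper.
Qed.

Theorem theorem0p1 (R : realType) (H : groupType) :
  (acts_properly_on_walls R H -> acts_properly_on_walls R (wreathZ H)) /\
  (acts_properly_on_cat0_cube_complex R H ->
   acts_properly_on_cat0_cube_complex R (wreathZ H)).
Proof. by split; [exact: wreath_acts_on_walls | exact: wreath_acts_on_cat0]. Qed.
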